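(* Let $R$ and $R^*$ be $A$-rings, $\phi:R\to R^*$ a morphism of $A$-rings, $Z=(Z_1,\dots,Z_N)$, and $z=(z_1,\dots,z_N)\in(R^* )^N$. Then $\phi$ extends uniquely to a morphism of $A$-rings $R\langle Z\rangle\to R^*$ sending $Z_1,\dots,Z_N$ to $z_1,\dots,z_N$ respectively.
   Context: All rings are commutative with $1$. $A$ is a noetherian ring with an ideal $\mathfrak{o}(A)\neq A$ such that $\bigcap_e\mathfrak{o}(A)^e=\{0\}$ and $A$ is $\mathfrak{o}(A)$-adically complete. $A\langle Y_1,\dots,Y_n\rangle$ is the ring of power series $\sum a_\nu Y^\nu$ over $A$ with $a_\nu\to0$ $\mathfrak{o}(A)$-adically; substitution of restricted power series into restricted power series is defined termwise. An $A$-ring is a ring $R$ with ring morphisms $\iota_n:A\langle Y_1,\dots,Y_n\rangle\to\{\text{functions }R^n\to R\}$ (write $f(y)=\iota_n(f)(y)$) such that (A1) $Y_k(y)=y_k$; (A2) adding a dummy last variable does not change values; (A3) for $n\ge1$ and $g=f(Y_{n+1},\dots,Y_{2n})$, $\iota_n(f)(y_{n+1},\dots,y_{2n})=\iota_{2n}(g)(y_1,\dots,y_{2n})$. A morphism of $A$-rings is a ring morphism $\phi$ with $\phi(f(y))=f(\phi(y_1),\dots,\phi(y_n))$ for all $f$ and $y$. For $h(X,Z)=\sum_\beta h_\beta(X)Z^\beta\in A\langle X,Z\rangle$ ($h_\beta\in A\langle X\rangle$, $X=(X_1,\dots,X_m)$) and $x\in R^m$ put $h(x,Z)=\sum_\beta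 h_\beta(x)Z^\beta\in R[[Z]]$. $R\langle Z\rangle$ is the set of all such $h(x,Z)$ ($m\in\mathbb{N}$, $h\in A\langle X,Z\rangle$, $x\in R^m$); it is a subring of $R[[Z]]$ and an $A$-ring extending $R$ via: for $f\in A\langle Y_1,\dots,Y_n\rangle$ and $u_j(X,Z)\in A\langle X,Z\rangle$, $f(u_1(x,Z),\dots,u_n(x,Z)):=g(x,Z)$ where $g=f(u_1(X,Z),\dots,u_n(X,Z))\in A\langle X,Z\rangle$ (this is well defined). *)

(* Defs.v *)
From HB Require Import structures.
From mathcomp Require Import all_boot all_algebra.
From mathcomp Require Import boolp classical_sets.
From mathcomp Require Import mpoly.
Set Implicit Arguments.
Unset Strict Implicit.
Unset Printing Implicit Defensive.
Import GRing.Theory.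
Local Open Scope ring_scope.

Lemma eq_big_bmnm (V : nmodType) (n b c : nat) (m : 'X_{1..n})
    (F : 'X_{1..n} -> V) : (mdeg m < b)%N -> (mdeg m < c)%N ->
  \sum_(i : 'X_{1..n < b} | (i <= m)%MM) F i =
  \sum_(i : 'X_{1..n < c} | (i <= m)%MM) F i.
Proof.
wlog le_bc : b c / (b <= c)%N => [W hb hc|].
  by case/orP: (leq_total b c) => h; [|symmetry]; exact: W.
move=> hb hc.
have degle (i : 'X_{1..n}) : (i <= m)%MM -> (mdeg i < b)%N.
  move=> /mnm_lepP le_im; apply: leq_ltn_trans hb.
  by rewrite !mdegE; apply: leq_sum => j _; exact: le_im.
rewrite [RHS](reindex_omap
  (fun i : 'X_{1..n < b} => BMultinom (leq_trans (bmdeg i) le_bc))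
  (fun i : 'X_{1..n < c} => insub (bmnm i))) /=; last first.
  by move=> i /degle hi; rewrite (insubT (fun i => (mdeg i < b)%N) hi) /=;
    congr Some; apply: val_inj.
apply: eq_bigl => i; rewrite valK eqxx andbT //.
Qed.

Section PowerSeries.
Variables (n : nat) (R : comPzRingType).

(* R[[X_1, ..., X_n]]: a series is its family of coefficients. *)
Record mpseries : predArgType :=
  MPSeries { pscoef :> 'X_{1..n} -> R }.

HB.instance Definition _ := [isNew for pscoef].
HB.instance Definition _ := [Choice of mpseries by <:].

Implicit Types f g h : mpseries.

Lemma mpseriesP f g : f =1 g -> f = g.
Proof. by case: f g => [f] [g] /= /funext ->. Qed.

Definition ps0 := MPSeries (fun=> 0).
Definition psopp f := MPSeries (fun m => - f m).
Definition psadd f g := MPSeries (fun m => f m + g m).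
Definition ps1 := MPSeries (fun m => (m == 0%MM)%:R).
Definition psmul f g := MPSeries (fun m =>
  \sum_(i : 'X_{1..n < (mdeg m).+1} | (i <= m)%MM) f i * g (m - i)%MM).

Fact psaddA : associative psadd.
Proof. by move=> f g h; apply: mpseriesP => m /=; rewrite addrA. Qed.
Fact psaddC : commutative psadd.
Proof. by move=> f g; apply: mpseriesP => m /=; rewrite addrC. Qed.
Fact psadd0 : left_id ps0 psadd.
Proof. by move=> f; apply: mpseriesP => m /=; rewrite add0r. Qed.
Fact psaddN : left_inverse ps0 psopp psadd.
Proof. by move=> f; apply: mpseriesP => m /=; rewrite addNr. Qed.

HB.instance Definition _ :=
  GRing.isZmodule.Build mpseries psaddA psaddC psadd0 psaddN.

Lemma psmulE b f g m : (mdeg m < b)%N ->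
  psmul f g m = \sum_(i : 'X_{1..n < b} | (i <= m)%MM) f i * g (m - i)%MM.
Proof.
by move=> hb /=; exact: (eq_big_bmnm (fun i => f i * g (m - i)%MM)).
Qed.

Fact psmulC : commutative psmul.
Proof.
move=> f g; apply: mpseriesP => m /=.
have sub_b (i : 'X_{1..n}) : (mdeg (m - i) < (mdeg m).+1)%N.
  by rewrite ltnS mdegB.
have subK (i : 'X_{1..n}) : (i <= m)%MM -> (m - (m - i))%MM = i.
  by move=> /mnm_lepP h; apply/mnmP => j; rewrite !mnmBE subKn.
pose r (i : 'X_{1..n < (mdeg m).+1}) := BMultinom (sub_b i).
rewrite (reindex_onto r r) /=; last first.
  by move=> i /subK h; apply: val_inj.
apply: eq_big => [i|i /andP[_ /eqP/(congr1 val)/= h]].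
  rewrite lem_subr /=; apply/eqP/idP => [/(congr1 val)/= <-|/subK h].
    exact: lem_subr.
  exact: val_inj.
by rewrite h mulrC.
Qed.

Fact psmulA : associative psmul.
Proof.
move=> f g h; apply: mpseriesP => m.
pose b := (mdeg m).+1; have hb : (mdeg m < b)%N by [].
have hs i : (mdeg (m - i) < b)%N by rewrite ltnS mdegB.
pose c3 (i j : 'X_{1..n}) := f i * (g (m - i - j)%MM * h j).
rewrite (psmulE _ _ hb) [psmul (psmul f g) h]psmulC (psmulE _ _ hb).
transitivity (\sum_(i : 'X_{1..n < b} | (i <= m)%MM)
                \sum_(j : 'X_{1..n < b} | (j <= m - i)%MM) c3 i j).
  apply: eq_bigr => i _; rewrite [psmul g h]psmulC (psmulE _ _ (hs i)).
  by rewrite big_distrr; apply: eq_bigr => j _; rewrite /c3 [h _ * _]mulrC.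
rewrite (exchange_big_dep (fun j : 'X_{1..n < b} => (j <= m)%MM)); last first.
  by move=> i j _ /lepm_trans; apply; exact: lem_subr.
apply: eq_bigr => j /mnm_lepP le_jm.
rewrite (psmulE _ _ (hs j)) mulrC big_distrl /=.
apply: eq_big => [i|i _]; last by rewrite /c3 mulrA !submDA addmC.
apply/andP/idP => [[/mnm_lepP h1 /mnm_lepP h2]|h1].
  apply/mnm_lepP => k; move: (h1 k) (h2 k) (le_jm k); rewrite !mnmBE.
  by move=> ? ? ?; rewrite leq_subRL // addnC -leq_subRL.
have h2 : (i <= m)%MM by rewrite (lepm_trans h1) ?lem_subr.
split=> //; apply/mnm_lepP => k.
move/mnm_lepP/(_ k): h1; move/mnm_lepP/(_ k): h2; rewrite !mnmBE => h2.
by rewrite !leq_subRL // addnC.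
Qed.

Fact psmul1 : left_id ps1 psmul.
Proof.
move=> f; apply: mpseriesP => m /=.
rewrite (bigD1 (bm0 : 'X_{1..n < (mdeg m).+1})) /=; last by apply/mnm_lepP => i; rewrite mnmE.
rewrite eqxx mul1r subm0 big1 ?addr0 // => i /andP[_ i0].
by rewrite -(inj_eq val_inj) /= in i0; rewrite (negPf i0) mul0r.
Qed.

Fact psmulDl : left_distributive psmul psadd.
Proof.
move=> f g h; apply: mpseriesP => m /=.
by rewrite -big_split; apply: eq_bigr => i _; rewrite mulrDl.
Qed.

HB.instance Definition _ := GRing.Zmodule_isComPzRing.Build mpseries
  psmulA psmulC psmul1 psmulDl.

(* The monomial X^m. *)
Definition psmon (m : 'X_{1..n}) : mpseries := MPSeries (fun k => (k == m)%:R).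
Definition psconst (a : R) : mpseries :=
  MPSeries (fun m => if m == 0%MM then a else 0).

Lemma coefD f g m : (f + g) m = f m + g m. Proof. by []. Qed.
Lemma coefN f m : (- f) m = - f m. Proof. by []. Qed.
Lemma coef_sum I r (P : pred I) (F : I -> mpseries) m :
  (\sum_(i <- r | P i) F i) m = \sum_(i <- r | P i) F i m.
Proof. exact: (big_morph (fun f : mpseries => f m)). Qed.

Lemma coefM b f g m : (mdeg m < b)%N ->
  (f * g) m = \sum_(i : 'X_{1..n < b} | (i <= m)%MM) f i * g (m - i)%MM.
Proof. exact: psmulE. Qed.

Lemma coefCM a g m : (psconst a * g) m = a * g m.
Proof.
rewrite (coefM _ _ (ltnSn _)) (bigD1 (bm0 : 'X_{1..n < (mdeg m).+1})) /=; last first.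
  by apply/mnm_lepP => i; rewrite mnmE.
rewrite eqxx subm0 big1 ?addr0 // => i /andP[_ i0].
by rewrite -(inj_eq val_inj) /= in i0; rewrite (negPf i0) mul0r.
Qed.

Lemma coef_monM k g m :
  (psmon k * g) m = if (k <= m)%MM then g (m - k)%MM else 0.
Proof.
have hb : (mdeg m < (mdeg m + mdeg k).+1)%N by rewrite ltnS leq_addr.
have hk : (mdeg k < (mdeg m + mdeg k).+1)%N by rewrite ltnS leq_addl.
rewrite (coefM _ _ hb); case: ifPn => le_km; last first.
  rewrite big1 // => i le_im /=; case: eqP => [ik|]; last by rewrite mul0r.
  by rewrite -ik le_im in le_km.
rewrite (bigD1 (BMultinom hk)) //= eqxx mul1r big1 ?addr0 // => i /andP[_ ik].
by rewrite -(inj_eq val_inj) /= in ik; rewrite (negPf ik) mul0r.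
Qed.

Lemma psmon0 : psmon 0%MM = 1. Proof. by []. Qed.
Lemma psmonD k l : psmon (k + l)%MM = psmon k * psmon l.
Proof.
apply: mpseriesP => m; rewrite coef_monM /=.
case: ifPn => [le_km|nle_km].
  by rewrite -{1}(submK le_km) addmC eqm_add2l.
by case: eqP nle_km => // ->; rewrite lem_addr.
Qed.
Lemma psmonX k e : psmon (k *+ e)%MM = psmon k ^+ e.
Proof. by elim: e => [|e IH]; rewrite ?mulm0n // mulmS exprS psmonD IH. Qed.
Lemma psmon_sum I r (P : pred I) (F : I -> 'X_{1..n}) :
  psmon (\sum_(i <- r | P i) F i)%MM = \prod_(i <- r | P i) psmon (F i).
Proof. exact: (big_morph psmon psmonD psmon0). Qed.

End PowerSeries.

Section Adic.
Variable A : comPzRingType.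
Implicit Types I : set A.

Definition is_ideal I : Prop :=
  [/\ I 0, forall x y, I x -> I y -> I (x + y) & forall a x, I x -> I (a * x)].

Definition noetherian : Prop :=
  forall I, is_ideal I -> exists k (g : 'I_k -> A),
    forall x, I x <-> exists c : 'I_k -> A, x = \sum_i c i * g i.

Fixpoint ideal_exp I (e : nat) : set A :=
  if e is e'.+1 then
    fun x => exists k (a b : 'I_k -> A),
      [/\ forall i, I (a i), forall i, ideal_exp I e' (b i) &
          x = \sum_i a i * b i]
  else setT.

Definition adic_cvg I (s : nat -> A) (l : A) : Prop :=
  forall e, exists N, forall i, (N <= i)%N -> ideal_exp I e (s i - l).

Definition adic_cauchy I (s : nat -> A) : Prop :=
  forall e, exists N, forall i j, (N <= i)%N -> (N <= j)%N ->
    ideal_exp I e (s i - s j).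

End Adic.

(* The nontriviality of adic_sort is no restriction: it follows from
   adic_o_proper. *)
Record adicRing := AdicRing {
  adic_sort :> comNzRingType;
  adic_o : set adic_sort;
  adic_o_ideal : is_ideal adic_o;
  adic_o_proper : adic_o <> setT;
  adic_noetherian : noetherian adic_sort;
  adic_separated : forall x, (forall e, ideal_exp adic_o e x) -> x = 0;
  adic_complete : forall s, adic_cauchy adic_o s -> exists l, adic_cvg adic_o s l
}.

Section AdicTheory.
Variable A : adicRing.
Local Notation o_ := (ideal_exp (@adic_o A)).

Lemma o_ideal e : is_ideal (o_ e).
Proof.
elim: e => [|e [IH0 IHD IHM]]; first by split.
split.
- by exists 0%N, (fun=> 0), (fun=> 0); split=> [i|i|]; [case: i..|rewrite big_ord0].
- move=> x y [k [a [b [ha hb ->]]]] [k' [a' [b' [ha' hb' ->]]]].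
  exists (k + k')%N,
    (fun i => match split i with inl j => a j | inr j => a' j end),
    (fun i => match split i with inl j => b j | inr j => b' j end).
  split=> [i|i|]; [by case: split..|].
  rewrite big_split_ord; congr (_ + _); apply: eq_bigr => i _.
    by rewrite (unsplitK (inl i)).
  by rewrite (unsplitK (inr i)).
- move=> c x [k [a [b [ha hb ->]]]]; exists k, a, (fun i => c * b i).
  split=> // [i|]; first exact/IHM/hb.
  by rewrite big_distrr; apply: eq_bigr => i _; rewrite mulrCA.
Qed.

Lemma o0 e : o_ e 0. Proof. by case: (o_ideal e). Qed.
Lemma oD e x y : o_ e x -> o_ e y -> o_ e (x + y).
Proof. by case: (o_ideal e) => _ + _; apply. Qed.
Lemma oMl e a x : o_ e x -> o_ e (a * x).
Proof. by case: (o_ideal e) => _ _; apply. Qed.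
Lemma oMr e a x : o_ e x -> o_ e (x * a).
Proof. by rewrite mulrC; apply: oMl. Qed.
Lemma oN e x : o_ e x -> o_ e (- x).
Proof. by rewrite -mulN1r; apply: oMl. Qed.
Lemma oB e x y : o_ e x -> o_ e y -> o_ e (x - y).
Proof. by move=> ? ?; apply: oD => //; apply: oN. Qed.
Lemma o_sum e I r (P : pred I) (F : I -> A) :
  (forall i, P i -> o_ e (F i)) -> o_ e (\sum_(i <- r | P i) F i).
Proof. by move=> h; apply: big_ind => //; [exact: o0|exact: oD]. Qed.

Lemma adic_cvg_unique s l l' :
  adic_cvg (@adic_o A) s l -> adic_cvg (@adic_o A) s l' -> l = l'.
Proof.
move=> h h'; apply/eqP; rewrite -subr_eq0; apply/eqP/adic_separated => e.
have [N hN] := h e; have [N' hN'] := h' e; pose i := maxn N N'.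
rewrite (_ : l - l' = (s i - l') - (s i - l)).
  by apply: oB; [apply: hN'; rewrite leq_maxr|apply: hN; rewrite leq_maxl].
by rewrite opprB [RHS]addrC subrKA.
Qed.

(* Limits are unique by adic_cvg_unique; the value 0 is used when there is no
   limit. *)
Definition adic_lim (s : nat -> A) : A := xget 0 [set l | adic_cvg (@adic_o A) s l].

Lemma adic_limP s l : adic_cvg (@adic_o A) s l -> adic_lim s = l.
Proof. by move=> h; apply: xget_unique => // l' h'; apply: adic_cvg_unique h' h. Qed.

Section Sums.
Variable n : nat.
Implicit Type c : 'X_{1..n} -> A.

(* Only finitely many m have degree less than d, so this says that for each e
   all but finitely many coefficients lie in o(A)^e. *)
Definition adic_null c : Prop :=
  forall e, exists d, forall m : 'X_{1..n}, (d <= mdeg m)%N -> o_ e (c m).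

Definition psum c (d : nat) : A := \sum_(m : 'X_{1..n < d}) c m.

Definition adic_sum c : A := adic_lim (psum c).

Lemma psumB c i j : (i <= j)%N ->
  psum c j - psum c i = \sum_(m : 'X_{1..n < j} | (i <= mdeg m)%N) c m.
Proof.
move=> le_ij; apply/eqP; rewrite subr_eq; apply/eqP.
rewrite /psum (bigID (fun m : 'X_{1..n < j} => (i <= mdeg m)%N)) /=; congr (_ + _).
rewrite (reindex_omap
  (fun m : 'X_{1..n < i} => BMultinom (leq_trans (bmdeg m) le_ij))
  (fun m : 'X_{1..n < j} => insub (bmnm m))) /=; last first.
  move=> m; rewrite -ltnNge => hm.
  by rewrite (insubT (fun m => (mdeg m < i)%N) hm) /=; congr Some; apply: val_inj.
by apply: eq_bigl => m; rewrite valK eqxx andbT -ltnNge bmdeg.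
Qed.

Lemma psumB_o c e d i j :
  (forall m : 'X_{1..n}, (d <= mdeg m)%N -> o_ e (c m)) ->
  (d <= i)%N -> (d <= j)%N -> o_ e (psum c j - psum c i).
Proof.
move=> hd; wlog le_ij : i j / (i <= j)%N => [W hi hj|hi hj].
  case/orP: (leq_total i j) => h; first exact: W.
  by rewrite -opprB; apply: oN; exact: W.
rewrite psumB //; apply: o_sum => m hm; apply: hd; exact: leq_trans hm.
Qed.

Lemma adic_sum_cvg c : adic_null c -> adic_cvg (@adic_o A) (psum c) (adic_sum c).
Proof.
move=> hc; suff [l hl] : exists l, adic_cvg (@adic_o A) (psum c) l.
  by rewrite /adic_sum (adic_limP hl).
apply: adic_complete => e; have [d hd] := hc e.
by exists d => i j hi hj; apply: psumB_o hd _ _.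
Qed.

Lemma adic_sumB_o c e d : adic_null c ->
  (forall m : 'X_{1..n}, (d <= mdeg m)%N -> o_ e (c m)) ->
  o_ e (adic_sum c - psum c d).
Proof.
move=> hc hd; have [N hN] := adic_sum_cvg hc e; pose i := maxn N d.
rewrite (_ : _ - _ = (psum c i - psum c d) - (psum c i - adic_sum c)).
  apply: oB; first by apply: psumB_o hd _ _; rewrite ?leq_maxr.
  by apply: hN; rewrite leq_maxl.
by rewrite opprB [RHS]addrC subrKA.
Qed.

End Sums.

Section Restricted.
Variable n : nat.

Definition restricted : pred (mpseries n A) := fun f => `[< adic_null f >].

Fact restricted_subring : subring_closed restricted.
Proof.
split.
- apply/asboolP => e; exists 1%N => m; rewrite lt0n mdeg_eq0 => /negPf m0.
  by rewrite /= m0; apply: o0.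
- move=> f g /asboolP hf /asboolP hg; apply/asboolP => e.
  have [d hd] := hf e; have [d' hd'] := hg e; exists (maxn d d') => m.
  by rewrite geq_max => /andP[h h']; apply: oB; [exact: hd|exact: hd'].
- move=> f g /asboolP hf /asboolP hg; apply/asboolP => e.
  have [d hd] := hf e; have [d' hd'] := hg e; exists (d + d')%N => m hm.
  apply: o_sum => i /mnm_lepP le_im.
  have [h|h] := leqP d (mdeg i); first by apply: oMr; apply: hd.
  apply: oMl; apply: hd'; move: hm.
  rewrite -{1}(submK (_ : i <= m)%MM); last exact/mnm_lepP.
  rewrite mdegD => hm; rewrite leqNgt; apply/negP => h'.
  by move: hm; rewrite leqNgt addnC -addSn leq_add // ltnW.
Qed.

HB.instance Definition _ :=
  GRing.isSubringClosed.Build (mpseries n A) restricted restricted_subring.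

(* A<Y_1, ..., Y_n> *)
Record tate : predArgType :=
  Tate { tate_val :> mpseries n A; _ : restricted tate_val }.

HB.instance Definition _ := [isSub for tate_val].
HB.instance Definition _ := [Choice of tate by <:].
HB.instance Definition _ := 
  GRing.SubChoice_isSubComPzRing.Build _ _ tate restricted_subring.

HB.instance Definition _ :=
  GRing.RMorphism.copy tate_val (\val : tate -> mpseries n A).

Lemma tateP (f g : tate) : (forall m, f m = g m) -> f = g.
Proof. by move=> h; apply/val_inj/mpseriesP. Qed.

Lemma tate_null (f : tate) : adic_null f.
Proof. exact/asboolP/(valP f). Qed.

Fact psmon_restricted m : restricted (psmon _ m).
Proof.
apply/asboolP => e; exists (mdeg m).+1 => k h /=.
by case: eqP h => [->|_ _]; [rewrite ltnn|exact: o0].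
Qed.

Definition tvar (i : 'I_n) : tate := Tate (psmon_restricted U_(i)%MM).

Fact psconst_restricted a : restricted (psconst n a).
Proof.
apply/asboolP => e; exists 1%N => m; rewrite lt0n mdeg_eq0 => /negPf m0.
by rewrite /= m0; apply: o0.
Qed.

End Restricted.

Section Substitution.
Variables n k : nat.
Implicit Types (f : tate n) (u : 'I_n -> tate k).

(* u^nu = u_1^nu_1 ... u_n^nu_n *)
Definition tate_pow u (nu : 'X_{1..n}) : tate k := \prod_i u i ^+ nu i.

(* f(u_1, ..., u_n) = \sum_nu f_nu u^nu, the sum being taken coefficientwise
   in the adic topology of A. *)
Definition subst_series f u : mpseries k A :=
  MPSeries (fun mu => adic_sum (fun nu => f nu * tate_pow u nu mu)).

Lemma subst_null f u mu : adic_null (fun nu => f nu * tate_pow u nu mu).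
Proof.
by move=> e; have [d hd] := tate_null f e; exists d => m /hd; apply: oMr.
Qed.

Fact subst_restricted f u : restricted (subst_series f u).
Proof.
apply/asboolP => e; have [d hd] := tate_null f e.
pose g : mpseries k A :=
  \sum_(nu : 'X_{1..n < d}) psconst k (f nu) * tate_pow u nu.
have /asboolP/(_ e)[d' hd'] : restricted g.
  apply: rpred_sum => nu _; apply: rpredM; last exact: (valP (tate_pow u nu)).
  exact: psconst_restricted.
exists d' => mu /hd' hmu /=.
rewrite -(subrK (g mu) (adic_sum _)); apply: oD => //.
rewrite [g mu]coef_sum.
under [X in _ - X]eq_bigr do rewrite coefCM.
apply: (adic_sumB_o (subst_null f u mu)) => nu /hd; exact: oMr.
Qed.

Definition tsubst f u : tate k := Tate (subst_restricted f u).

End Substitution.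

End AdicTheory.

Section Renaming.
Variable A : adicRing.

Lemma adic_sum_fin n (c : 'X_{1..n} -> A) d :
  (forall m : 'X_{1..n}, (d <= mdeg m)%N -> c m = 0) -> adic_sum c = psum c d.
Proof.
move=> h; apply: adic_limP => e; exists d => i di.
by apply: psumB_o (leqnn d) di => m /h ->; exact: o0.
Qed.

Lemma adic_sum1 n (c : 'X_{1..n} -> A) m0 :
  (forall m, m != m0 -> c m = 0) -> adic_sum c = c m0.
Proof.
move=> h; rewrite (adic_sum_fin (d := (mdeg m0).+1)) => [|m hm]; last first.
  by apply: h; apply: contraTneq hm => ->; rewrite ltnn.
rewrite /psum (bigD1 (BMultinom (ltnSn (mdeg m0)))) //= big1 ?addr0 // => m.
by rewrite -(inj_eq val_inj) /= => /h.
Qed.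

Lemma adic_sum0 n (c : 'X_{1..n} -> A) : (forall m, c m = 0) -> adic_sum c = 0.
Proof. by move=> h; rewrite (adic_sum1 (m0 := 0%MM)). Qed.

Definition mnm_push n k (s : 'I_n -> 'I_k) (nu : 'X_{1..n}) : 'X_{1..k} :=
  (\sum_i U_(s i) *+ nu i)%MM.

Lemma push_comp n k l (s : 'I_n -> 'I_k) (t : 'I_k -> 'I_l) nu :
  mnm_push (t \o s) nu = mnm_push t (mnm_push s nu).
Proof.
apply/mnmP => j; rewrite !mnm_sumE.
under eq_bigr do rewrite mulmnE mnm1E.
under [RHS]eq_bigr do rewrite mulmnE mnm1E mnm_sumE big_distrr /=.
rewrite exchange_big /=; apply: eq_bigr => i _; rewrite (bigD1 (s i)) //=.
rewrite mulmnE mnm1E eqxx mul1n big1 ?addn0 // => i' ne.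
by rewrite mulmnE mnm1E [s i == _]eq_sym (negPf ne) muln0.
Qed.

Lemma pushE n k (s : 'I_n -> 'I_k) nu i : injective s -> mnm_push s nu (s i) = nu i.
Proof.
move=> inj_s; rewrite mnm_sumE (bigD1 i) //= mulmnE mnm1E eqxx mul1n.
rewrite big1 ?addn0 // => j ne; rewrite mulmnE mnm1E (inj_eq inj_s).
by rewrite (negPf ne).
Qed.

Lemma push_inj n k (s : 'I_n -> 'I_k) : injective s -> injective (mnm_push s).
Proof.
by move=> inj_s a b eab; apply/mnmP => i; rewrite -!(pushE _ i inj_s) eab.
Qed.

Definition trename n k (s : 'I_n -> 'I_k) (f : tate A n) : tate A k :=
  tsubst f (fun i => tvar A (s i)).

Lemma tate_pow_var n k (s : 'I_n -> 'I_k) nu :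
  tate_pow (fun i => tvar A (s i)) nu = psmon A (mnm_push s nu) :> mpseries k A.
Proof.
rewrite /tate_pow /mnm_push psmon_sum rmorph_prod.
by apply: eq_bigr => i _; rewrite psmonX rmorphXn.
Qed.

Lemma trename_push n k (s : 'I_n -> 'I_k) f nu : injective s ->
  trename s f (mnm_push s nu) = f nu.
Proof.
move=> inj_s; rewrite /= (adic_sum1 (m0 := nu)) => [|m ne].
  by rewrite tate_pow_var /= eqxx mulr1.
by rewrite tate_pow_var /= (inj_eq (push_inj inj_s)) eq_sym (negPf ne) mulr0.
Qed.

Lemma trename_npush n k (s : 'I_n -> 'I_k) f mu :
  (forall nu, mu <> mnm_push s nu) -> trename s f mu = 0.
Proof.
move=> h /=; apply: adic_sum0 => nu; rewrite tate_pow_var /=.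
by case: eqP (h nu) => // _ _; rewrite mulr0.
Qed.

Lemma trename_comp n k l (s : 'I_n -> 'I_k) (t : 'I_k -> 'I_l) f :
  injective s -> injective t ->
  trename t (trename s f) = trename (t \o s) f.
Proof.
move=> inj_s inj_t; apply: tateP => mu.
have inj_ts : injective (t \o s) by apply: inj_comp.
case: (pselect (exists nu, mu = mnm_push t nu)) => [[nu ->]|h]; last first.
  rewrite !trename_npush // => nu e; apply: h; last by exists nu.
  by exists (mnm_push s nu); rewrite -push_comp.
rewrite trename_push //.
case: (pselect (exists k0, nu = mnm_push s k0)) => [[k0 ->]|h]; last first.
  rewrite !trename_npush // => k0 e; apply: h; exists k0 => //.
  by apply: (push_inj inj_t); rewrite e push_comp.
by rewrite -push_comp !trename_push.
Qed.

Definition mnm_cat m N (a : 'X_{1..m}) (b : 'X_{1..N}) : 'X_{1..m + N} :=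
  [multinom match split i with inl j => a j | inr j => b j end | i < m + N].

Lemma mnm_catl m N (a : 'X_{1..m}) (b : 'X_{1..N}) i :
  mnm_cat a b (lshift N i) = a i.
Proof. by rewrite mnmE (unsplitK (inl i)). Qed.
Lemma mnm_catr m N (a : 'X_{1..m}) (b : 'X_{1..N}) i :
  mnm_cat a b (rshift m i) = b i.
Proof. by rewrite mnmE (unsplitK (inr i)). Qed.

Lemma mnm_catP m N (c c' : 'X_{1..m + N}) :
  (forall i, c (lshift N i) = c' (lshift N i)) ->
  (forall i, c (rshift m i) = c' (rshift m i)) -> c = c'.
Proof.
by move=> hl hr; apply/mnmP => i; rewrite -(splitK i); case: split => j /=.
Qed.

Lemma mnm_cat_inj m N (a a' : 'X_{1..m}) (b b' : 'X_{1..N}) :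
  mnm_cat a b = mnm_cat a' b' -> a = a' /\ b = b'.
Proof.
move=> e; split; apply/mnmP => i.
  by rewrite -(mnm_catl a b) e mnm_catl.
by rewrite -(mnm_catr a b) e mnm_catr.
Qed.

Lemma mnm_catK m N (c : 'X_{1..m + N}) :
  c = mnm_cat [multinom c (lshift N i) | i < m] [multinom c (rshift m i) | i < N].
Proof.
by apply: mnm_catP => i; rewrite ?mnm_catl ?mnm_catr mnmE.
Qed.

Lemma mdeg_cat m N (a : 'X_{1..m}) (b : 'X_{1..N}) :
  mdeg (mnm_cat a b) = (mdeg a + mdeg b)%N.
Proof.
rewrite !mdegE big_split_ord /=.
by congr (_ + _)%N; apply: eq_bigr => i _; rewrite (mnm_catl, mnm_catr).
Qed.

Section Zcoef.
Variables m N : nat.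

Fact zcoef_restricted (h : tate A (m + N)) (b : 'X_{1..N}) :
  restricted (MPSeries (fun a : 'X_{1..m} => h (mnm_cat a b))).
Proof.
apply/asboolP => e; have [d hd] := tate_null h e; exists d => a ha.
by apply: hd; rewrite mdeg_cat (leq_trans ha) ?leq_addr.
Qed.

(* The variables of h : A<X, Z> are X_1, ..., X_m followed by Z_1, ..., Z_N;
   zcoef h b is the series h_b of A<X> in h = \sum_b h_b(X) Z^b. *)
Definition zcoef h b : tate A m := Tate (zcoef_restricted h b).

Lemma zcoefB h h' b : zcoef (h - h') b = zcoef h b - zcoef h' b.
Proof. exact: tateP. Qed.

Lemma zcoef1 b : zcoef 1 b = (b == 0%MM)%:R.
Proof.
apply: tateP => a /=; case: (eqVneq b 0%MM) => [->|b0] /=.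
  congr (_ %:R); congr nat_of_bool; apply/eqP/eqP => [e|->]; last first.
    by apply: mnm_catP => i; rewrite ?mnm_catl ?mnm_catr !mnm0E.
  by apply/mnmP => i; move/mnmP/(_ (lshift N i)): e; rewrite mnm_catl !mnm0E.
case: eqP => // e; case/eqP: b0.
by apply/mnmP => i; move/mnmP/(_ (rshift m i)): e; rewrite mnm_catr !mnm0E.
Qed.

Lemma mnm_cat_le (a a' : 'X_{1..m}) (b b' : 'X_{1..N}) :
  (mnm_cat a b <= mnm_cat a' b')%MM = (a <= a')%MM && (b <= b')%MM.
Proof.
apply/mnm_lepP/andP => [h|[/mnm_lepP ha /mnm_lepP hb] i].
  split; apply/mnm_lepP => i.
    by move: (h (lshift N i)); rewrite !mnm_catl.
  by move: (h (rshift m i)); rewrite !mnm_catr.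
by rewrite -(splitK i); case: split => j /=; rewrite ?mnm_catl ?mnm_catr.
Qed.

Lemma mnm_catB (a a' : 'X_{1..m}) (b b' : 'X_{1..N}) :
  (mnm_cat a b - mnm_cat a' b')%MM = mnm_cat (a - a')%MM (b - b')%MM.
Proof.
by apply: mnm_catP => i; rewrite mnmBE ?mnm_catl ?mnm_catr mnmBE.
Qed.

Lemma zcoefM h h' b :
  zcoef (h * h') b =
  \sum_(c : 'X_{1..N < (mdeg b).+1} | (c <= b)%MM) zcoef h c * zcoef h' (b - c)%MM.
Proof.
apply: tateP => a.
have -> : pscoef (\sum_(c : 'X_{1..N < (mdeg b).+1} | (c <= b)%MM)
    zcoef h c * zcoef h' (b - c)%MM) a = 
  \sum_(c : 'X_{1..N < (mdeg b).+1} | (c <= b)%MM)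
    (zcoef h c * zcoef h' (b - c)%MM : mpseries m A) a.
  by rewrite (raddf_sum (@tate_val A m)) coef_sum.
pose B := (mdeg a + mdeg b).+1.
have hab : (mdeg (mnm_cat a b) < B)%N by rewrite mdeg_cat.
have ha : (mdeg a < B)%N by rewrite ltnS leq_addr.
have hb : (mdeg b < B)%N by rewrite ltnS leq_addl.
rewrite (eq_big_bmnm (fun c => (zcoef h c * zcoef h' (b - c)%MM : mpseries m A) a)
  (ltnSn _) hb).
under eq_bigr do rewrite (coefM _ _ ha).
rewrite [LHS](coefM _ _ (leq_trans hab (leq_addl B B))).
rewrite pair_big /=.
have hcat (p : 'X_{1..N < B} * 'X_{1..m < B}) : (mdeg (mnm_cat p.2 p.1) < B + B)%N.
  rewrite mdeg_cat; apply: (leq_trans (n := B + mdeg p.1)).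
    by rewrite ltn_add2r bmdeg.
  by rewrite leq_add2l ltnW // bmdeg.
pose F (p : 'X_{1..N < B} * 'X_{1..m < B}) := BMultinom (hcat p).
pose G (c : 'X_{1..(m + N) < (B + B)}) : option ('X_{1..N < B} * 'X_{1..m < B}) :=
  match insub [multinom c (rshift m i) | i < N],
        insub [multinom c (lshift N i) | i < m] with
  | Some q, Some p => Some (q, p) | _, _ => None end.
have GF p : G (F p) = Some p.
  have e1 : [multinom (F p) (rshift m i) | i < N] = val p.1.
    by apply/mnmP => i; rewrite mnmE mnm_catr.
  have e2 : [multinom (F p) (lshift N i) | i < m] = val p.2.
    by apply/mnmP => i; rewrite mnmE mnm_catl.
  by rewrite /G e1 e2 !valK; case: p {e1 e2}.
have mono l (x y : 'X_{1..l}) : (x <= y)%MM -> (mdeg x <= mdeg y)%N.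
  by move=> /mnm_lepP le; rewrite !mdegE; apply: leq_sum => j _; exact: le.
rewrite (reindex_omap F G) /=; last first.
  move=> c; rewrite [bmnm c in X in X -> _]mnm_catK mnm_cat_le.
  move=> /andP[/mono h1 /mono h2]; rewrite /G.
  rewrite (insubT (fun x => (mdeg x < B)%N) (leq_ltn_trans h1 ha)).
  rewrite (insubT (fun x => (mdeg x < B)%N) (leq_ltn_trans h2 hb)) /=.
  by congr Some; apply: val_inj; rewrite /= -mnm_catK.
apply: eq_big => [p|p _]; first by rewrite GF eqxx andbT mnm_cat_le andbC.
by rewrite mnm_catB.
Qed.

End Zcoef.

Definition sum_ord m m' N (s : 'I_m -> 'I_m') (i : 'I_(m + N)) : 'I_(m' + N) :=
  match split i with inl j => lshift N (s j) | inr j => rshift m' j end.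

Lemma sum_ord_inj m m' N (s : 'I_m -> 'I_m') :
  injective s -> injective (@sum_ord m m' N s).
Proof.
move=> inj_s i j; rewrite /sum_ord -{2}(splitK i) -{2}(splitK j).
case: (split i) => a; case: (split j) => b /=.
- by move=> /lshift_inj/inj_s ->.
- by move/eqP; rewrite eq_lrshift.
- by move/eqP; rewrite eq_rlshift.
- by move=> /rshift_inj ->.
Qed.

Lemma push_sum_ord m m' N (s : 'I_m -> 'I_m') a (b : 'X_{1..N}) :
  mnm_push (sum_ord s) (mnm_cat a b) = mnm_cat (mnm_push s a) b.
Proof.
apply: mnm_catP => j; rewrite ?mnm_catl ?mnm_catr !mnm_sumE big_split_ord /=.
  rewrite [X in (_ + X)%N]big1 ?addn0 => [|i _].
    apply: eq_bigr => i _; rewrite !mulmnE !mnm1E mnm_catl /sum_ord.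
    by rewrite (unsplitK (inl i)) (inj_eq (@lshift_inj _ _)).
  by rewrite mulmnE mnm1E /sum_ord (unsplitK (inr i)) eq_rlshift.
rewrite big1 ?add0n => [|i _]; last first.
  by rewrite mulmnE mnm1E /sum_ord (unsplitK (inl i)) eq_lrshift.
rewrite (bigD1 j) //= mulmnE mnm1E mnm_catr /sum_ord (unsplitK (inr j)) eqxx.
rewrite mul1n big1 ?addn0 // => i ne.
by rewrite mulmnE mnm1E (unsplitK (inr i)) (inj_eq (@rshift_inj _ _)) (negPf ne).
Qed.

Lemma zcoef_rename m m' N (s : 'I_m -> 'I_m') (h : tate A (m + N)) b :
  injective s -> zcoef (trename (sum_ord s) h) b = trename s (zcoef h b).
Proof.
move=> inj_s; have inj_S := sum_ord_inj (N := N) inj_s.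
apply: tateP => a.
case: (pselect (exists a0, a = mnm_push s a0)) => [[a0 ->]|na].
  rewrite trename_push // -[LHS]/(trename (sum_ord s) h (mnm_cat (mnm_push s a0) b)).
  by rewrite -push_sum_ord trename_push.
rewrite [RHS]trename_npush => [|a0 e]; last by apply: na; exists a0.
apply: trename_npush => nu; rewrite {1}[nu]mnm_catK push_sum_ord.
by move=> /mnm_cat_inj[e _]; apply: na; eexists; exact: e.
Qed.

End Renaming.

Section Arings.
Variable A : adicRing.

(* The data of an A-ring structure, without the axioms. *)
Definition Aops (R : comPzRingType) : Type :=
  forall n, tate A n -> ('I_n -> R) -> R.

Definition ring_morphism (R S : comPzRingType) (f : R -> S) : Prop :=
  nmod_morphism f /\ monoid_morphism f.

(* Operations on functions R^n -> R are pointwise, so Aiota_morph says that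
   Aiota is a ring morphism from A<Y_1, ..., Y_n> to such functions.  In
   Aiota_dummy, f is regarded as a series in one more variable by substituting
   Y_1, ..., Y_n, variables of A<Y_1, ..., Y_(n+1)>, into it. *)
Record Aring := ARing {
  Aring_sort :> comPzRingType;
  Aiota : Aops Aring_sort;
  Aiota_morph : forall n (y : 'I_n -> Aring_sort),
    ring_morphism (fun f => Aiota f y);
  Aiota_var : forall n (k : 'I_n) (y : 'I_n -> Aring_sort),
    Aiota (tvar A k) y = y k;
  Aiota_dummy : forall n (f : tate A n) (y : 'I_n.+1 -> Aring_sort),
    Aiota (tsubst f (fun k => tvar A (widen_ord (leqnSn n) k))) y =
    Aiota f (fun k => y (widen_ord (leqnSn n) k));
  Aiota_shift : forall n (f : tate A n) (y : 'I_(n + n) -> Aring_sort),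
    (0 < n)%N ->
    Aiota f (fun k => y (rshift n k)) =
    Aiota (tsubst f (fun k => tvar A (rshift n k))) y
}.

Definition Aring_morphism (R S : comPzRingType) (iR : Aops R) (iS : Aops S)
    (phi : R -> S) : Prop :=
  ring_morphism phi /\
  forall n (f : tate A n) (y : 'I_n -> R),
    phi (iR n f y) = iS n f (fun k => phi (y k)).

Section Rangle.
Variables (R : Aring) (N : nat).

(* h(x, Z) *)
Definition zspec m (h : tate A (m + N)) (x : 'I_m -> R) : mpseries N R :=
  MPSeries (fun b => Aiota (zcoef h b) x).

Definition in_rangle : pred (mpseries N R) := fun p =>
  `[< exists m (h : tate A (m + N)) (x : 'I_m -> R), p = zspec h x >].

Lemma AiotaB n (f g : tate A n) (y : 'I_n -> R) :
  Aiota (f - g) y = Aiota f y - Aiota g y.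
Proof.
have [[f0 fD] _] := Aiota_morph y.
by apply/esym/eqP; rewrite subr_eq -fD subrK.
Qed.
Lemma AiotaM n (f g : tate A n) (y : 'I_n -> R) :
  Aiota (f * g) y = Aiota f y * Aiota g y.
Proof. by have [_ [_ +]] := Aiota_morph y; apply. Qed.
Lemma Aiota1 n (y : 'I_n -> R) : Aiota (1 : tate A n) y = 1.
Proof. by have [_ [+ _]] := Aiota_morph y. Qed.
Lemma Aiota0 n (y : 'I_n -> R) : Aiota (0 : tate A n) y = 0.
Proof. by have [[+ _] _] := Aiota_morph y. Qed.
Lemma Aiota_sum n (y : 'I_n -> R) I r (P : pred I) (F : I -> tate A n) :
  Aiota (\sum_(i <- r | P i) F i) y = \sum_(i <- r | P i) Aiota (F i) y.
Proof.
by have [[f0 fD] _] := Aiota_morph y; apply: (big_morph (fun f => Aiota f y)).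
Qed.

Lemma specB m (h h' : tate A (m + N)) x : zspec (h - h') x = zspec h x - zspec h' x.
Proof. by apply: mpseriesP => b /=; rewrite zcoefB AiotaB. Qed.
Lemma spec1 m (x : 'I_m -> R) : zspec 1 x = 1.
Proof.
apply: mpseriesP => b /=; rewrite zcoef1.
by case: (b == 0%MM); rewrite ?Aiota1 ?Aiota0.
Qed.
Lemma specM m (h h' : tate A (m + N)) x : zspec (h * h') x = zspec h x * zspec h' x.
Proof.
apply: mpseriesP => b /=; rewrite zcoefM Aiota_sum.
by apply: eq_bigr => c _; rewrite AiotaM.
Qed.

Definition good_renaming n k (s : 'I_n -> 'I_k) : Prop := injective s /\
  forall f (y : 'I_k -> R), Aiota (trename s f) y = Aiota f (y \o s).

Lemma good_comp n k l (s : 'I_n -> 'I_k) (t : 'I_k -> 'I_l) :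
  good_renaming s -> good_renaming t -> good_renaming (t \o s).
Proof.
move=> [inj_s hs] [inj_t ht]; split; first exact: inj_comp.
by move=> f y; rewrite -trename_comp // ht hs.
Qed.

Lemma trename_id n (f : tate A n) : trename id f = f.
Proof.
have pid nu : mnm_push id nu = nu :> 'X_{1..n}.
  by apply/mnmP => i; exact: (pushE nu i (@inj_id _)).
by apply: tateP => mu; rewrite -{1}(pid mu) trename_push.
Qed.

Lemma good_widen n k (le_nk : (n <= k)%N) : good_renaming (widen_ord le_nk).
Proof.
suff H (s : 'I_n -> 'I_k) : (forall i, s i = i :> nat) -> good_renaming s by exact: H.
elim: k le_nk s => [|k IH] le_nk s hs.
  have en : n = 0%N by apply/eqP; rewrite -leqn0.
  subst n; have -> : s = id by apply/funext; case.
  by split=> // f y; rewrite trename_id.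
have [en|ne] := eqVneq n k.+1.
  subst n; have -> : s = id by apply/funext => i; apply: val_inj; exact: hs.
  by split=> // f y; rewrite trename_id.
have lt_nk : (n <= k)%N by rewrite -ltnS ltn_neqAle ne.
have -> : s = widen_ord (leqnSn k) \o widen_ord lt_nk.
  by apply/funext => i; apply: val_inj; exact: hs.
apply: good_comp; first exact: IH.
by split=> [i j /(congr1 val)/= /val_inj|f y] //; exact: Aiota_dummy.
Qed.

Lemma good_rshift n : (0 < n)%N -> good_renaming (@rshift n n).
Proof. by move=> n0; split=> [|f y]; [exact: rshift_inj|rewrite /trename -Aiota_shift]. Qed.

Lemma spec_rename m k (s : 'I_m -> 'I_k) (h : tate A (m + N)) y : good_renaming s ->
  zspec (trename (sum_ord s) h) y = zspec h (y \o s).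
Proof.
by move=> [inj_s hs]; apply: mpseriesP => b; rewrite /= zcoef_rename // hs.
Qed.

Lemma rangle_merge m m' (x : 'I_m -> R) (x' : 'I_m' -> R) :
  exists k (y : 'I_k -> R) (s : 'I_m -> 'I_k) (s' : 'I_m' -> 'I_k),
    [/\ good_renaming s, good_renaming s', x = y \o s & x' = y \o s'].
Proof.
pose k := (maxn m m').+1.
have le_m : (m <= k)%N by rewrite leqW ?leq_maxl.
have le_m' : (m' <= k)%N by rewrite leqW ?leq_maxr.
pose pad l (z : 'I_l -> R) (i : 'I_k) := if insub (val i) is Some j then z j else 0.
have padE l (le : (l <= k)%N) z : z = pad l z \o widen_ord le.
  by apply/funext => i /=; rewrite /pad /= valK.
exists (k + k)%N,
  (fun i => match split i with inl j => pad _ x j | inr j => pad _ x' j end),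
  (widen_ord (leq_addr k k) \o widen_ord le_m), (@rshift k k \o widen_ord le_m').
split.
- by apply: good_comp; exact: good_widen.
- by apply: good_comp; [exact: good_widen|exact: good_rshift].
- rewrite {1}(padE _ le_m x); apply/funext => i /=.
  have -> : widen_ord (leq_addr k k) (widen_ord le_m i) = lshift k (widen_ord le_m i).
    exact: val_inj.
  by rewrite (unsplitK (inl _)).
- rewrite {1}(padE _ le_m' x'); apply/funext => i /=.
  by rewrite (unsplitK (inr _)).
Qed.

Lemma rangle_common p q : in_rangle p -> in_rangle q ->
  exists k (h h' : tate A (k + N)) (y : 'I_k -> R), p = zspec h y /\ q = zspec h' y.
Proof.
move=> /asboolP[m [h [x ->]]] /asboolP[m' [h' [x' ->]]].
have [k [y [s [s' [gs gs' -> ->]]]]] := rangle_merge x x'.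
exists k, (trename (sum_ord s) h), (trename (sum_ord s') h'), y.
by rewrite !spec_rename.
Qed.

Fact rangle_subring : subring_closed in_rangle.
Proof.
split.
- by apply/asboolP; exists 0%N, 1, (fun=> 0); rewrite spec1.
- move=> p q /rangle_common h /h [k [u [v [y [-> ->]]]]].
  by apply/asboolP; exists k, (u - v), y; rewrite specB.
- move=> p q /rangle_common h /h [k [u [v [y [-> ->]]]]].
  by apply/asboolP; exists k, (u * v), y; rewrite specM.
Qed.

(* R<Z_1, ..., Z_N>, as a subring of R[[Z_1, ..., Z_N]]. *)
Record rangle : predArgType :=
  Rangle { rangle_val :> mpseries N R; _ : in_rangle rangle_val }.

HB.instance Definition _ := [isSub for rangle_val].
HB.instance Definition _ := [Choice of rangle by <:].
HB.instance Definition _ :=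
  GRing.SubChoice_isSubComPzRing.Build _ _ rangle rangle_subring.

Fact spec_in_rangle m (h : tate A (m + N)) x : in_rangle (zspec h x).
Proof. by apply/asboolP; exists m, h, x. Qed.

Definition rangle_zspec m (h : tate A (m + N)) x : rangle :=
  Rangle (spec_in_rangle h x).

Fact const_in_rangle (r : R) : in_rangle (psconst N r).
Proof.
apply/asboolP; exists 1%N, (tvar A (lshift N ord0)), (fun=> r).
apply: mpseriesP => b /=.
have catU (a : 'X_{1..1}) :
    (mnm_cat a b == U_(lshift N ord0)%MM) = (a == U_(ord0)%MM) && (b == 0%MM).
  have -> : U_(lshift N (ord0 : 'I_1))%MM =
      mnm_cat U_(ord0 : 'I_1)%MM (0%MM : 'X_{1..N}).
    apply: (@mnm_catP 1 N) => i; rewrite ?mnm_catl ?mnm_catr !mnmE.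
      by rewrite (inj_eq (@lshift_inj _ _)).
    by rewrite eq_lrshift.
  by apply/eqP/andP => [/mnm_cat_inj[-> ->]|[/eqP-> /eqP->]].
case: eqP => [b0|/eqP/negPf nb0].
  rewrite (_ : zcoef _ b = tvar A ord0) ?Aiota_var //.
  by apply: tateP => a /=; rewrite catU b0 eqxx andbT.
by rewrite (_ : zcoef _ b = 0) ?Aiota0 //; apply: tateP => a /=; rewrite catU nb0 andbF.
Qed.

Fact var_in_rangle (k : 'I_N) : in_rangle (psmon R U_(k)%MM).
Proof.
apply/asboolP; exists 0%N, (tvar A (rshift 0 k)), (fun=> 0).
apply: mpseriesP => b /=.
have catU (a : 'X_{1..0}) : (mnm_cat a b == U_(rshift 0 k)%MM) = (b == U_(k)%MM).
  have -> : U_(rshift 0 k)%MM = mnm_cat a U_(k)%MM.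
    apply: (@mnm_catP 0 N) => i; first by case: i.
    by rewrite mnm_catr !mnmE (inj_eq (@rshift_inj _ _)).
  by apply/eqP/eqP => [/mnm_cat_inj[]|->].
case: eqP => [b1|/eqP/negPf nb1].
  rewrite (_ : zcoef _ b = 1) ?Aiota1 //; apply: tateP => a /=.
  rewrite catU b1 eqxx (_ : a == 0%MM) //.
  by apply/eqP/mnmP; case.
by rewrite (_ : zcoef _ b = 0) ?Aiota0 //; apply: tateP => a /=; rewrite catU nb1.
Qed.

Definition rangle_const (r : R) : rangle := Rangle (const_in_rangle r).
Definition rangle_var (k : 'I_N) : rangle := Rangle (var_in_rangle k).

(* f(u_1(x, Z), ..., u_n(x, Z)) := f(u_1, ..., u_n)(x, Z).  Any v_1, ..., v_n
   can be written with a common x (see rangle_merge), and the result does not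
   depend on the choice of x and u since A is noetherian; the default value 0
   of xget is thus never relevant. *)
Definition rangle_iota : Aops rangle := fun n f v =>
  xget 0 [set w : rangle | exists m (u : 'I_n -> tate A (m + N)) (x : 'I_m -> R),
    (forall j, v j = rangle_zspec (u j) x) /\ w = rangle_zspec (tsubst f u) x].

End Rangle.

End Arings.

(* Main.v *)
From HB Require Import structures.
From mathcomp Require Import all_boot all_algebra.
From mathcomp Require Import boolp classical_sets.
From mathcomp Require Import mpoly.
Require Import Defs.

(* The extension must send h(x, Z) to h(phi(x), z), because h(x, Z) is the
   value of h at the constants x and the variables Z; the issue is that this is
   well defined.  If h(x, Z) = 0, then h_c(x) = 0 for all c, so it suffices that
   h be a combination, with coefficients in A<X, Z>, of finitely many of the
   h_c(X).  Let t_1, ..., t_r generate o(A).  The initial forms, in A[X][T], of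
   the elements of the ideal I of A<X> generated by the h_c generate an ideal
   that is finitely generated by Hilbert's basis theorem.  By successive
   approximation this gives a finite family in I over which every element of I
   lying in o(A)^e A<X> has coefficients in o(A)^(e - D) A<X>, for a fixed D.
   Applied to h_b this yields coefficients tending to 0 with b, which assemble
   into restricted power series in (X, Z).

   The other ingredient is that f(v) - f(w) lies in the ideal generated by the
   v_i - w_i.  It shows that evaluation in an A-ring commutes with substitution,
   and that the operations of R<Z> are well defined. *)

Set Implicit Arguments.
Unset Strict Implicit.
Unset Printing Implicit Defensive.
Import GRing.Theory.
Local Open Scope ring_scope.

(** * The Hilbert basis theorem *)

Definition in_span (R : comPzRingType) (a : nat -> R) (n : nat) (x : R) : Prop :=
  exists c : nat -> R, x = \sum_(i < n) c i * a i.

Section InSpan.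
Variables (R : comPzRingType) (a : nat -> R).

Lemma in_span0 n : in_span a n 0.
Proof. by exists (fun=> 0); rewrite big1 // => i _; rewrite mul0r. Qed.

Lemma in_spanD n x y : in_span a n x -> in_span a n y -> in_span a n (x + y).
Proof.
move=> [c ->] [c' ->]; exists (fun i => c i + c' i).
by rewrite -big_split; apply: eq_bigr => i _; rewrite mulrDl.
Qed.

Lemma in_spanM n b x : in_span a n x -> in_span a n (b * x).
Proof.
move=> [c ->]; exists (fun i => b * c i).
by rewrite big_distrr; apply: eq_bigr => i _; rewrite /= mulrA.
Qed.

Lemma in_span_nth n i : (i < n)%N -> in_span a n (a i).
Proof.
move=> lt_in; exists (fun j => (j == i)%:R).
rewrite (bigD1 (Ordinal lt_in)) //= eqxx mul1r big1 ?addr0 // => j.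
by rewrite -(inj_eq val_inj) /= => /negPf ->; rewrite mul0r.
Qed.

Lemma in_span_sum n I r (P : pred I) (F : I -> R) :
  (forall i, P i -> in_span a n (F i)) -> in_span a n (\sum_(i <- r | P i) F i).
Proof.
by move=> h; apply: big_ind => //; [exact: in_span0|exact: in_spanD].
Qed.

Lemma in_span_widen n n' x : (n <= n')%N -> in_span a n x -> in_span a n' x.
Proof.
move=> le_nn' [c ->]; apply: in_span_sum => i _; apply/in_spanM/in_span_nth.
exact: leq_trans le_nn'.
Qed.

End InSpan.

Lemma eq_in_span (R : comPzRingType) (a b : nat -> R) n x :
  (forall i, (i < n)%N -> a i = b i) -> in_span a n x -> in_span b n x.
Proof.
by move=> eab [c ->]; exists c; apply: eq_bigr => i _; rewrite eab.
Qed.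

(** The union of the spans of all prefixes of [a] is an ideal. Its finitely many generators already
    lie in the span of one prefix, and hence so does the next term. *)
Lemma noetherian_seq (R : comPzRingType) : noetherian R ->
  forall a : nat -> R, exists n, in_span a n (a n).
Proof.
move=> noeR a; pose I : set R := [set x | exists n, in_span a n x]%classic.
have idI : is_ideal I.
  split; first by exists 0%N; exact: in_span0.
    move=> x y [n hx] [n' hy]; exists (maxn n n').
    by apply: in_spanD; [apply: in_span_widen hx|apply: in_span_widen hy];
      rewrite ?leq_maxl ?leq_maxr.
  by move=> b x [n hx]; exists n; exact: in_spanM.
have [k [g gP]] := noeR I idI.
have /choice[d dP] : forall i, exists n, in_span a n (g i).
  move=> i; suff : I (g i) by []; apply/gP; exists (fun j => (j == i)%:R).
  rewrite (bigD1 i) //= eqxx mul1r big1 ?addr0 // => j /negPf ->.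
  by rewrite mul0r.
pose n := \max_i d i; exists n.
have [c ->] : exists c : 'I_k -> R, a n = \sum_i c i * g i.
  by apply/gP; exists n.+1; exact: in_span_nth.
apply: in_span_sum => i _; apply: in_spanM; apply: in_span_widen (dP i).
exact: leq_bigmax.
Qed.

Fixpoint greedy (R : comPzRingType) (pick : seq R -> R) n : seq R :=
  if n is n'.+1 then rcons (greedy pick n') (pick (greedy pick n')) else [::].

Lemma size_greedy (R : comPzRingType) (pick : seq R -> R) n :
  size (greedy pick n) = n.
Proof. by elim: n => //= n IH; rewrite size_rcons IH. Qed.

Lemma nth_greedy (R : comPzRingType) (pick : seq R -> R) n i : (i < n)%N ->
  nth 0 (greedy pick n) i = pick (greedy pick i).
Proof.
elim: n => //= n IH; rewrite ltnS leq_eqVlt nth_rcons size_greedy.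
by case: eqP => [->|_ /= lt_in]; [rewrite ltnn|rewrite lt_in IH].
Qed.

(** If no finite subset of [G] sufficed, one could go on forever choosing an element of [G] outside
    the span so far, of least weight [w] among these; by hypothesis such a sequence cannot exist. A
    constant [w] gives plain noetherianity, [w = size] gives Hilbert's argument. *)
Lemma greedy_gen (R : comPzRingType) (G : set R) (w : R -> nat) :
    (forall a : nat -> R, (forall n, G (a n)) ->
       (forall n y, G y -> ~ in_span a n y -> (w (a n) <= w y)%N) ->
       exists n, in_span a n (a n)) ->
  exists n (a : nat -> R), (forall i, (i < n)%N -> G (a i)) /\
    forall y, G y -> in_span a n y.
Proof.
move=> hG; apply: contrapT => nfg.
have nx (s : seq R) : exists x, (forall i, (i < size s)%N -> G (nth 0 s i)) ->
    [/\ G x, ~ in_span (nth 0 s) (size s) x &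
      forall y, G y -> ~ in_span (nth 0 s) (size s) y -> (w x <= w y)%N].
  (* A list with an entry outside [G] is never reached; [0] is a dummy choice for it. *)
  case: (pselect (forall i, (i < size s)%N -> G (nth 0 s i))); last by exists 0.
  move=> Gs.
  pose P k := `[< exists x, [/\ G x, ~ in_span (nth 0 s) (size s) x & w x = k] >].
  have exP : exists k, P k.
    apply: contrapT => nP; apply: nfg; exists (size s), (nth 0 s); split=> // y Gy.
    by apply: contrapT => ny; apply: nP; exists (w y); apply/asboolP; exists y.
  case: (ex_minnP exP) => k /asboolP[x [Gx nx wx]] kmin; exists x => _.
  by split=> // y Gy ny; rewrite wx; apply: kmin; apply/asboolP; exists y.
have [pick pickP] := choice nx.
have nthG n i : (i < size (greedy pick n))%N -> G (nth 0 (greedy pick n) i).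
  rewrite size_greedy; elim/ltn_ind: n i => n IH i lt_in; rewrite nth_greedy //.
  by have [] := pickP (greedy pick i) => // j; rewrite size_greedy; exact: IH.
pose a n := pick (greedy pick n).
have nth_a n i : (i < n)%N -> a i = nth 0 (greedy pick n) i.
  by move=> lt_in; rewrite nth_greedy.
have spanE n y : in_span a n y ->
    in_span (nth 0 (greedy pick n)) (size (greedy pick n)) y.
  by rewrite size_greedy; apply: eq_in_span => i /nth_a.
have [|n y Gy ny|n /spanE h] := hG a.
- by move=> n; have [] := pickP _ (nthG n).
- have [_ _] := pickP _ (nthG n); apply=> // h; apply: ny.
  by rewrite size_greedy in h; apply: eq_in_span h => i /nth_a.
- by have [_ + _] := pickP _ (nthG n).
Qed.

(** The generators are taken from [G] itself, an arbitrary subset. This allows [G] to be the set of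
    initial forms, each of which comes with an element realizing it. *)
Lemma noetherian_gen (R : comPzRingType) (G : set R) : noetherian R ->
  exists n (a : nat -> R), (forall i, (i < n)%N -> G (a i)) /\
    forall y, G y -> in_span a n y.
Proof.
by move=> /noetherian_seq noeR; apply: (greedy_gen (w := fun=> 0%N)) => a _ _.
Qed.

Lemma in_span_ideal (R : comPzRingType) (I : set R) (a : nat -> R) n x :
  is_ideal I -> (forall i, (i < n)%N -> I (a i)) -> in_span a n x -> I x.
Proof.
move=> [I0 ID IM] Ia [c ->]; apply: big_ind => // i _.
by apply: IM; exact: Ia.
Qed.

Lemma noetherian_poly (R : comNzRingType) : noetherian R -> noetherian {poly R}.
Proof.
move=> /noetherian_seq noeR I idI; have [I0 ID IM] := idI.
have IN p : I p -> I (- p) by rewrite -mulN1r; apply: IM.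
have [|n [a [Ia genI]]] := @greedy_gen _ I (fun p => size p).
  move=> p Ip minp; have [n [c lc]] := noeR (fun n => lead_coef (p n)).
  exists n; apply: contrapT => np.
  have pn0 : p n != 0 by apply: contra_notN np => /eqP ->; exact: in_span0.
  have le_size (i : 'I_n) : (size (p i) <= size (p n))%N.
    apply: minp => // h; apply: np; apply: in_span_widen h; exact: ltnW.
  (* By minimality the earlier terms have size at most that of [p n]. Shifting them by powers of the
     variable gives a combination [q] with the same top coefficient as [p n], so [p n - q] has
     smaller size, against the minimality of [p n]. *)
  pose q := \sum_(i < n) ((c i)%:P * 'X^(size (p n) - size (p i))) * p i.
  have qspan : in_span p n q.
    by exists (fun i => (c i)%:P * 'X^(size (p n) - size (p i))).
  have size_q : (size q <= size (p n))%N.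
    apply: leq_trans (size_sum _ _ _) _; apply/bigmax_leqP => i _.
    rewrite -mulrA mul_polyC (leq_trans (size_scale_leq _ _)) // mulrC.
    have [->|pi0] := eqVneq (p i) 0; first by rewrite mul0r size_poly0.
    by rewrite size_mulXn // subnK.
  have lead_q : q`_(size (p n)).-1 = lead_coef (p n).
    rewrite lc poly.coef_sum; apply: eq_bigr => i _.
    rewrite -mulrA poly.coefCM coefXnM; congr (_ * _).
    have [pi0|pi0] := eqVneq (p i) 0.
      by rewrite pi0 lead_coef0 coef0 if_same.
    have sp : (0 < size (p i))%N by rewrite size_poly_gt0.
    have -> : ((size (p n)).-1 - (size (p n) - size (p i)) = (size (p i)).-1)%N.
      by rewrite -subn1 -subnDA addnC subnDA subKn ?subn1.
    rewrite ifF //; apply/negbTE; rewrite -leqNgt.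
    rewrite -subn1 leq_sub2l //.
  suff : (size (p n) <= size ((p n : {poly R}) - q)%R)%N.
    apply/negP; rewrite -ltnNge -(prednK (n := size (p n))) ?size_poly_gt0 // ltnS.
    apply/leq_sizeP => j; rewrite leq_eqVlt => /orP[/eqP<-|ltj].
      by rewrite coefB lead_q subrr.
    have le_j : (size (p n) <= j)%N by rewrite (leq_trans _ ltj) ?leqSpred.
    by rewrite coefB !nth_default ?subrr // (leq_trans size_q).
  apply: minp => [|h].
    apply: ID => //; apply: IN.
    by apply: in_span_ideal qspan => // i _.
  by apply: np; rewrite -(subrK q (p n)); exact: in_spanD.
exists n, (fun i => a i) => x; split=> [/genI[c ->]|[c ->]].
  by exists (fun i => c i).
by apply: big_ind => // i _; apply: IM; exact: Ia.
Qed.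

Lemma noetherian_surj (R S : comPzRingType) (f : {rmorphism R -> S}) :
  (forall y, exists x, y = f x) -> noetherian R -> noetherian S.
Proof.
move=> surj noeR I [I0 ID IM]; have [|k [g gP]] := noeR [set x | I (f x)]%classic.
  by split=> [|x y|b x]; rewrite /= ?rmorph0 ?rmorphD ?rmorphM //; [exact: ID|exact: IM].
exists k, (fun i => f (g i)) => y; have [x ->] := surj y.
split=> [/gP[c ->]|[c ->]].
  by exists (fun i => f (c i));
    rewrite rmorph_sum; apply: eq_bigr => i _; rewrite rmorphM.
apply: big_ind => // i _; apply: IM; apply/gP; exists (fun j => (j == i)%:R).
by rewrite (bigD1 i) //= eqxx mul1r big1 ?addr0 // => j /negPf ->; rewrite mul0r.
Qed.

(** Induction along the map from R[X_1, ..., X_n][X] to R[X_1, ..., X_(n+1)] that sends X to the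
    last variable; it is onto because its image is a subring containing the constants and the
    variables. *)
Lemma noetherian_mpoly (R : comNzRingType) n : noetherian R -> noetherian {mpoly R[n]}.
Proof.
move=> noeR; elim: n => [|n IHn].
  apply: (noetherian_surj (f := @mpolyC 0 R)) noeR => p; exists p@_0%MM.
  by rewrite {1}[p]nvar0_mpolyC.
pose F : {rmorphism {poly {mpoly R[n]}} -> {mpoly R[n.+1]}} :=
  horner_eval 'X_ord_max \o @mpwiden n R.
apply: (noetherian_surj (f := F)) (noetherian_poly IHn) => p.
have FX i : exists q, 'X_i = F q.
  case: (unliftP ord_max i) => [j ->|->].
    exists ('X_j)%:P; rewrite /F /= mpwidenC /horner_eval /= hornerC mwidenX.
    rewrite mnmwiden1; congr 'X_[U_(_)]; apply: val_inj.
    by rewrite /= /bump leqNgt ltn_ord.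
  by exists 'X; rewrite /F /= mpwidenX /horner_eval hornerX.
have FM x y : (exists q, x = F q) -> (exists q, y = F q) -> exists q, x * y = F q.
  by move=> [q ->] [q' ->]; exists (q * q'); rewrite rmorphM.
have F1 : exists q, 1 = F q by exists 1; rewrite rmorph1.
rewrite [p]mpolyE; apply: (big_ind (fun x => exists q, x = F q))
  => [|x y [q ->] [q' ->]|m _].
- by exists 0; rewrite rmorph0.
- by exists (q + q'); rewrite rmorphD.
rewrite -mul_mpolyC; apply: (FM).
  by exists ((p@_m)%:MP)%:P; rewrite /F /= mpwidenC /horner_eval /= hornerC mwidenC.
rewrite mpolyXE_id; apply: (big_ind (fun x => exists q, x = F q)) => // i _.
by elim: (m i) => [|k IH]; rewrite ?expr0 // exprS; apply: (FM).
Qed.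

(** * Topology of A<Y> and substitution *)

Section TateTopology.
Variable A : adicRing.
Local Notation o_ := (ideal_exp (@adic_o A)).

Lemma oS e (x : A) : o_ e.+1 x -> o_ e x.
Proof.
by move=> [k [a [b [_ hb ->]]]]; apply: o_sum => i _; apply/oMl/hb.
Qed.

Lemma o_le d e (x : A) : (d <= e)%N -> o_ e x -> o_ d x.
Proof.
by move=> /subnK <-; elim: (e - d)%N => // k IH /oS; exact: IH.
Qed.

Lemma o_mul d e (x y : A) : o_ d x -> o_ e y -> o_ (d + e) (x * y).
Proof.
elim: d x => [|d IH] x; first by move=> _ hy; exact: oMl.
move=> [k [a [b [ha hb ->]]]] hy; exists k, a, (fun i => b i * y).
split=> [//|i|]; first exact: (IH _ (hb i) hy).
by rewrite big_distrl; apply: eq_bigr => i _; rewrite /= mulrA.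
Qed.

Section TateO.
Variable k : nat.
Implicit Types p q : tate A k.

(* p belongs to o(A)^e A<Y_1, ..., Y_k> *)
Definition tate_o e p : Prop := forall mu, o_ e (p mu).

Lemma tate_o0 e : tate_o e 0. Proof. by move=> mu; exact: o0. Qed.
Lemma tate_oD e p q : tate_o e p -> tate_o e q -> tate_o e (p + q).
Proof. by move=> hp hq mu; exact: (oD (hp mu) (hq mu)). Qed.
Lemma tate_oN e p : tate_o e p -> tate_o e (- p).
Proof. by move=> hp mu; exact: (oN (hp mu)). Qed.
Lemma tate_oB e p q : tate_o e p -> tate_o e q -> tate_o e (p - q).
Proof. by move=> hp hq; apply: tate_oD => //; exact: tate_oN. Qed.
Lemma tate_oBC e p q : tate_o e (p - q) -> tate_o e (q - p).
Proof. by move=> /tate_oN; rewrite opprB. Qed.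
Lemma tate_o_sum e I r (P : pred I) (F : I -> tate A k) :
  (forall i, P i -> tate_o e (F i)) -> tate_o e (\sum_(i <- r | P i) F i).
Proof. by move=> h; apply: big_ind => //; [exact: tate_o0|exact: tate_oD]. Qed.
Lemma tate_o_mul d e p q : tate_o d p -> tate_o e q -> tate_o (d + e) (p * q).
Proof. by move=> hp hq mu; apply: o_sum => i _; exact: (o_mul (hp _) (hq _)). Qed.
Lemma tate_oMl e p q : tate_o e q -> tate_o e (p * q).
Proof. by move=> hq mu; apply: o_sum => i _; exact: (oMl _ (hq _)). Qed.
Lemma tate_o_le d e p : (d <= e)%N -> tate_o e p -> tate_o d p.
Proof. by move=> le hp mu; exact: (o_le le (hp mu)). Qed.

Lemma tate_o_trans e p q r : tate_o e (p - q) -> tate_o e (q - r) -> tate_o e (p - r).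
Proof. by move=> hp /(tate_oD hp); rewrite addrA subrK. Qed.

Lemma tate_separated p q : (forall e, tate_o e (p - q)) -> p = q.
Proof.
move=> h; apply: tateP => mu; apply/eqP; rewrite -subr_eq0; apply/eqP.
by apply: adic_separated => e; exact: (h e mu).
Qed.

Definition tate_cvg (s : nat -> tate A k) (l : tate A k) : Prop :=
  forall e, exists N, forall i, (N <= i)%N -> tate_o e (s i - l).

(** Limits are taken coefficientwise. The Cauchy condition is uniform in the monomial, so the limit
    is uniformly close to a single [s N] and inherits restrictedness from it. *)
Lemma tate_complete (s : nat -> tate A k) :
    (forall e, exists N, forall i j, (N <= i)%N -> (N <= j)%N ->
       tate_o e (s i - s j)) ->
  exists l, tate_cvg s l.
Proof.
move=> cauchy_s.
have /choice[l lP] : forall mu, exists a, adic_cvg (@adic_o A) (fun i => s i mu) a.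
  move=> mu; apply: adic_complete => e; have [N hN] := cauchy_s e.
  by exists N => i j hi hj; exact: (hN i j hi hj mu).
have lo e : exists N, forall i, (N <= i)%N -> forall mu, o_ e (s i mu - l mu).
  have [N hN] := cauchy_s e; exists N => i hi mu.
  have [N' hN'] := lP mu e; pose j := maxn N N'.
  rewrite -(subrK (s j mu) (s i mu)) -addrA.
  apply: oD; first exact: (hN i j hi (leq_maxl _ _) mu).
  by apply: hN'; exact: leq_maxr.
have lR : restricted (MPSeries l).
  apply/asboolP => e; have [N /(_ N (leqnn N)) hN] := lo e.
  have [d hd] := tate_null (s N) e; exists d => mu /hd h /=.
  by rewrite -(subKr (s N mu) (l mu)); apply: oB.
by exists (Tate lR).
Qed.

Definition tconst (a : A) : tate A k := Tate (psconst_restricted k a).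

Lemma tconstM a p mu : (tconst a * p) mu = a * p mu.
Proof. exact: coefCM. Qed.

Lemma tate_sumE I r (P : pred I) (F : I -> tate A k) mu :
  (\sum_(i <- r | P i) F i) mu = \sum_(i <- r | P i) F i mu.
Proof. by rewrite (raddf_sum (@tate_val A k)) coef_sum. Qed.

Definition tate_psum n (c : 'X_{1..n} -> A) (q : 'X_{1..n} -> tate A k) d : tate A k :=
  \sum_(nu : 'X_{1..n < d}) tconst (c nu) * q nu.

Lemma tate_psumE n (c : 'X_{1..n} -> A) (q : 'X_{1..n} -> tate A k) d mu :
  tate_psum c q d mu = psum (fun nu => c nu * q nu mu) d.
Proof. by rewrite tate_sumE; apply: eq_bigr => nu _; rewrite tconstM. Qed.

Lemma tate_series n (c : 'X_{1..n} -> A) (q : 'X_{1..n} -> tate A k) :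
  adic_null c -> exists l, tate_cvg (tate_psum c q) l.
Proof.
move=> c0; apply: tate_complete => e; have [d hd] := c0 e.
exists d => i j hi hj mu.
rewrite -[pscoef _ mu]/(tate_psum c q i mu - tate_psum c q j mu) !tate_psumE.
by apply: (psumB_o (d := d)) => // nu /hd; exact: oMr.
Qed.

(** Substitution is defined by coefficientwise limits, but the tails are bounded through the
    coefficients of [f] alone, hence uniformly in [mu]. *)
Lemma tsubst_cvg n (f : tate A n) u : tate_cvg (tate_psum f (tate_pow u)) (tsubst f u).
Proof.
move=> e; have [d hd] := tate_null f e; exists d => i hi; apply: tate_oBC => mu.
rewrite -[pscoef _ mu]/(tsubst f u mu - tate_psum f (tate_pow u) i mu) tate_psumE.
apply: adic_sumB_o; first exact: subst_null.
by move=> nu hnu; apply: oMr; apply: hd; exact: leq_trans hnu.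
Qed.

End TateO.

Definition gen_ideal (B : comPzRingType) (T : finType) (a : T -> B) : set B :=
  [set x | exists q : T -> B, x = \sum_i a i * q i]%classic.

Lemma gen_idealP (B : comPzRingType) (T : finType) (a : T -> B) : is_ideal (gen_ideal a).
Proof.
split.
- by exists (fun=> 0); rewrite big1 // => i _; rewrite mulr0.
- move=> x y [q ->] [q' ->]; exists (fun i => q i + q' i).
  by rewrite -big_split; apply: eq_bigr => i _; rewrite mulrDr.
- move=> b x [q ->]; exists (fun i => b * q i).
  by rewrite big_distrr; apply: eq_bigr => i _; rewrite /= mulrCA.
Qed.

Lemma gen_ideal_gen (B : comPzRingType) (T : finType) (a : T -> B) i : gen_ideal a (a i).
Proof.
exists (fun j => (j == i)%:R); rewrite (bigD1 i) //= eqxx mulr1 big1 ?addr0 //.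
by move=> j /negPf ->; rewrite mulr0.
Qed.

(** Congruence modulo an ideal is compatible with products. *)
Lemma monomial_congruence (B : comPzRingType) n (v w : 'I_n -> B) (nu : 'I_n -> nat) :
  gen_ideal (fun i => v i - w i) (\prod_i v i ^+ nu i - \prod_i w i ^+ nu i).
Proof.
have [J0 JD JM] := gen_idealP (fun i => v i - w i).
pose J := gen_ideal (fun i => v i - w i).
have congM x y x' y' : J (x - y) -> J (x' - y') -> J (x * x' - y * y').
  move=> h h'; rewrite -(subrK (y * x') (x * x')) -addrA -mulrBl -mulrBr.
  by apply: JD; [rewrite mulrC|]; apply: JM.
apply: (big_ind2 (fun x y => J (x - y))) => [|x y x' y' h h'|i _].
- by rewrite subrr.
- exact: congM.
elim: (nu i) => [|e IH]; first by rewrite !expr0 subrr.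
by rewrite !exprS; apply: congM => //; exact: gen_ideal_gen.
Qed.

(** Each monomial difference has cofactors [q nu i]. As the coefficients of [f] tend to 0, the
    series with terms [f nu] times [q nu i] converge whatever these cofactors are, and their sums
    are the cofactors for [f]. *)
Lemma tsubst_congruence n k (f : tate A n) (v w : 'I_n -> tate A k) :
  gen_ideal (fun i => v i - w i) (tsubst f v - tsubst f w).
Proof.
have /choice[q qP] : forall nu : 'X_{1..n}, exists q : 'I_n -> tate A k,
    tate_pow v nu - tate_pow w nu = \sum_i (v i - w i) * q i.
  by move=> nu; exact: monomial_congruence.
have /choice[l lP] : forall i, exists l,
    tate_cvg (tate_psum f (fun nu => q nu i)) l.
  by move=> i; apply: tate_series; exact: tate_null.
exists l; apply: tate_separated => e.
have [d1 h1] := tsubst_cvg f v e; have [d2 h2] := tsubst_cvg f w e.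
have /choice[d3 h3] : forall i, exists N, forall d, (N <= d)%N ->
    tate_o e (tate_psum f (fun nu => q nu i) d - l i).
  by move=> i; exact: lP.
pose d := maxn (maxn d1 d2) (\max_i d3 i).
pose S u := tate_psum f (tate_pow u) d : tate A k.
apply: (@tate_o_trans _ _ _ (S v - S w)).
  rewrite opprD opprK addrACA; apply: tate_oD.
    by apply: tate_oBC; apply: h1; rewrite !leq_max leqnn.
  by rewrite addrC; apply: h2; rewrite !leq_max leqnn orbT.
have -> : S v - S w =
    \sum_i (v i - w i) * tate_psum f (fun nu => q nu i) d.
  rewrite /S /tate_psum -sumrB; under [RHS]eq_bigr do rewrite big_distrr /=.
  rewrite exchange_big; apply: eq_bigr => nu _ /=.
  rewrite -mulrBr qP big_distrr; apply: eq_bigr => i _ /=; exact: mulrCA.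
rewrite -sumrB; apply: tate_o_sum => i _; rewrite -mulrBr; apply: tate_oMl.
by apply: h3; rewrite leq_max leq_bigmax orbT.
Qed.

End TateTopology.

(** * Renaming of variables and evaluation in A-rings *)

Section Push.
Variables (n k : nat) (s : 'I_n -> 'I_k).
Hypothesis inj_s : injective s.

Lemma mnm_push0 : mnm_push s 0 = 0%MM.
Proof. by rewrite /mnm_push big1 // => i _; rewrite mnm0E mulm0n. Qed.

Lemma mnm_pushU i : mnm_push s U_(i) = U_(s i)%MM.
Proof.
rewrite /mnm_push (bigD1 i) //= mnm1E eqxx mulm1n big1 ?addm0 // => j ne.
by rewrite mnm1E eq_sym (negPf ne) mulm0n.
Qed.

Lemma mnm_pushD a b : mnm_push s (a + b) = (mnm_push s a + mnm_push s b)%MM.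
Proof.
rewrite /mnm_push -big_split; apply: eq_bigr => i _.
by apply/mnmP => j /=; rewrite !(mnmDE, mulmnE) mulnDr.
Qed.

Lemma mdeg_push a : mdeg (mnm_push s a) = mdeg a.
Proof.
by rewrite mdeg_sum mdegE; apply: eq_bigr => i _; rewrite mdegMn mdeg1 mul1n.
Qed.

Lemma mnm_push_le a b : (mnm_push s a <= mnm_push s b)%MM = (a <= b)%MM.
Proof.
apply/idP/idP => [/mnm_lepP h|le_ab]; last by rewrite -(submK le_ab) mnm_pushD lem_addl.
by apply/mnm_lepP => i; move: (h (s i)); rewrite !pushE.
Qed.

Lemma mnm_pushB a b : (a <= b)%MM ->
  (mnm_push s b - mnm_push s a)%MM = mnm_push s (b - a).
Proof. by move=> le_ab; rewrite -{1}(submK le_ab) mnm_pushD addmK. Qed.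

Definition mnm_pull (i : 'X_{1..k}) : 'X_{1..n} := [multinom i (s j) | j < n].

Lemma mnm_pushK a : mnm_pull (mnm_push s a) = a.
Proof. by apply/mnmP => i; rewrite mnmE pushE. Qed.

(** A variable outside the image of [s] has exponent 0 in [mnm_push s a], hence also in the divisor
    [i], so pulling back loses nothing. *)
Lemma mnm_pullK i a : (i <= mnm_push s a)%MM -> mnm_push s (mnm_pull i) = i.
Proof.
move=> /mnm_lepP le_ia; apply/mnmP => j.
case: (pselect (exists j0, j = s j0)) => [[j0 ->]|nj]; first by rewrite pushE // mnmE.
have push_out b : mnm_push s b j = 0%N.
  rewrite mnm_sumE big1 // => l _; rewrite mulmnE mnm1E.
  by case: eqP => // e; case: nj; exists l.
by apply/eqP; rewrite push_out eq_sym -leqn0 -(push_out a).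
Qed.

End Push.

Section Trename.
Variables (A : adicRing) (n k : nat) (s : 'I_n -> 'I_k).
Hypothesis inj_s : injective s.

Lemma trename_ext (f : tate A n) (g : tate A k) :
    (forall nu, g (mnm_push s nu) = f nu) ->
    (forall mu, (forall nu, mu <> mnm_push s nu) -> g mu = 0) ->
  trename s f = g.
Proof.
move=> g1 g2; apply: tateP => mu.
case: (pselect (exists nu, mu = mnm_push s nu)) => [[nu ->]|nmu].
  by rewrite trename_push // g1.
have nmu' nu : mu <> mnm_push s nu by move=> e; apply: nmu; exists nu.
by rewrite trename_npush // g2.
Qed.

Lemma trename_var i : trename s (tvar A i) = tvar A (s i).
Proof.
apply: trename_ext => [nu|mu nmu] /=.
  by rewrite -mnm_pushU (inj_eq (push_inj inj_s)).
by case: eqP => // muE; case: (nmu U_(i)%MM); rewrite mnm_pushU.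
Qed.

Lemma trename1 : trename s (1 : tate A n) = 1.
Proof.
apply: trename_ext => [nu|mu nmu] /=.
  by rewrite -{1}(mnm_push0 s) (inj_eq (push_inj inj_s)).
by case: eqP => // mu0; case: (nmu 0%MM); rewrite mnm_push0.
Qed.

(** Divisors of a pushed monomial are pushed, so on the image the two convolution sums match term by
    term. Off the image no product of two pushed monomials contributes. *)
Lemma trenameM (f g : tate A n) : trename s (f * g) = trename s f * trename s g.
Proof.
apply: trename_ext => [nu|mu nmu]; last first.
  rewrite [LHS](coefM _ _ (ltnSn _)) big1 // => i le_i.
  case: (pselect (exists a, bmnm i = mnm_push s a)) => [[a ea]|na]; last first.
    by rewrite trename_npush ?mul0r // => a ea; apply: na; exists a.
  rewrite [X in _ * X]trename_npush ?mulr0 // => b eb; apply: (nmu (b + a)%MM).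
  by rewrite mnm_pushD -ea -eb submK.
pose B := (mdeg nu).+1.
have hB : (mdeg (mnm_push s nu) < B)%N by rewrite mdeg_push.
rewrite [LHS](coefM _ _ hB) [RHS](coefM _ _ (ltnSn _)).
have degF (a : 'X_{1..n < B}) : (mdeg (mnm_push s a) < B)%N by rewrite mdeg_push bmdeg.
pose F (a : 'X_{1..n < B}) := BMultinom (degF a).
pose G (i : 'X_{1..k < B}) : option 'X_{1..n < B} := insub (mnm_pull s i).
have valF a : bmnm (F a) = mnm_push s a by [].
rewrite (reindex_omap F G); last first.
  move=> i /(mnm_pullK inj_s) ei; rewrite /G.
  have hi : (mdeg (mnm_pull s i) < B)%N.
    by rewrite -(mdeg_push s) ei bmdeg.
  by rewrite (insubT (fun a => (mdeg a < B)%N) hi) /=; congr Some; apply: val_inj.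
apply: eq_big => [a|a /andP[]].
  by rewrite valF mnm_push_le // /G valF mnm_pushK // valK eqxx andbT.
by rewrite valF mnm_push_le // => le_a _; rewrite mnm_pushB // !trename_push.
Qed.

Lemma trename_pow l (u : 'I_l -> tate A n) nu :
  trename s (tate_pow u nu) = tate_pow (fun i => trename s (u i)) nu.
Proof.
rewrite /tate_pow (big_morph _ trenameM trename1); apply: eq_bigr => i _.
by elim: (nu i) => [|e IH]; rewrite ?expr0 ?trename1 // !exprS trenameM IH.
Qed.

Lemma trename_tsubst l (f : tate A l) (u : 'I_l -> tate A n) :
  trename s (tsubst f u) = tsubst f (fun i => trename s (u i)).
Proof.
apply: trename_ext => [nu|mu nmu].
  congr adic_sum; apply/funext => m; congr (_ * _).
  by rewrite -trename_pow trename_push.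
by apply: adic_sum0 => m; rewrite -trename_pow trename_npush ?mulr0.
Qed.

End Trename.

Section AringSubst.
Variables (A : adicRing) (R : Aring A).

Lemma Aiota_gen_ideal k n (a : 'I_n -> tate A k) (y : 'I_k -> R) p :
  (forall i, Aiota (a i) y = 0) -> gen_ideal a p -> Aiota p y = 0.
Proof.
move=> a0 [q ->]; rewrite Aiota_sum big1 // => i _.
by rewrite AiotaM a0 mul0r.
Qed.

(* f(Y) - f(u(X)) lies in the ideal generated by the Y_i - u_i(X), all of which
   vanish at (y, u(y)). *)
Lemma Aiota_tsubst n k (f : tate A n) (u : 'I_n -> tate A k) (y : 'I_k -> R) :
  Aiota (tsubst f u) y = Aiota f (fun i => Aiota (u i) y).
Proof.
have [l [w [s [s' [[inj_s gs] [inj_s' gs'] ey eu]]]]] :=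
  rangle_merge y (fun i => Aiota (u i) y).
rewrite {1}ey eu -gs -gs'; apply/eqP; rewrite -subr_eq0 -AiotaB; apply/eqP.
rewrite trename_tsubst //.
apply: Aiota_gen_ideal (tsubst_congruence _ _ _) => i.
by rewrite AiotaB Aiota_var gs -ey -[w (s' i)]/((w \o s') i) -eu subrr.
Qed.

Lemma Aiota_trename n k (s : 'I_n -> 'I_k) f (y : 'I_k -> R) :
  Aiota (trename s f) y = Aiota f (y \o s).
Proof.
by rewrite Aiota_tsubst; congr Aiota; apply/funext => i; rewrite Aiota_var.
Qed.

End AringSubst.

(** * Initial forms *)

Section TateNz.
Variables (A : adicRing) (m : nat).

Fact tate_nonzero : (1 : tate A m) != 0.
Proof.
apply/negP => /eqP/(congr1 (fun f : tate A m => f 0%MM)) /= /eqP.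
by rewrite eqxx oner_eq0.
Qed.

HB.instance Definition _ :=
  GRing.PzSemiRing_isNonZero.Build (tate A m) tate_nonzero.

Fact tconst_nmod : nmod_morphism (@tconst A m).
Proof.
split=> [|a b]; apply: tateP => mu; first by rewrite /= if_same.
rewrite /= -[RHS]/((tconst m a) mu + (tconst m b) mu) /=.
by case: ifP => // _; rewrite addr0.
Qed.

Fact tconst_monoid : monoid_morphism (@tconst A m).
Proof.
split=> [|a b]; apply: tateP => mu; first by rewrite /=; case: ifP.
by rewrite tconstM /=; case: ifP => // _; rewrite mulr0.
Qed.

HB.instance Definition _ := GRing.isNmodMorphism.Build _ _ (@tconst A m) tconst_nmod.
HB.instance Definition _ := GRing.isMonoidMorphism.Build _ _ (@tconst A m) tconst_monoid.

End TateNz.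


(** Only the homogeneous piece of [P] of degree [e - d] contributes in degree [e]. The test [d <= e]
    matters because [e - d] truncates to 0. *)
Lemma pihomogMr n (C : nzRingType) d e (P F : {mpoly C[n]}) :
  F \is d.-homog for mdeg ->
  pihomog mdeg e (P * F) = (if (d <= e)%N then pihomog mdeg (e - d) P else 0) * F.
Proof.
move=> hF; pose k := maxn (mmeasure mdeg P) e.+1.
rewrite {1}(pihomog_partitionE (k := k) (leq_maxl _ _) : P = _).
rewrite big_distrl linear_sum /=.
have piece i : pihomog mdeg i P * F \is (i + d).-homog for mdeg.
  by apply: dhomogM => //; exact: pihomogP.
case: ifP => [le_de|/negbT]; last first.
  rewrite -ltnNge mul0r => lt_ed; rewrite big1 // => i _.
  apply: (pihomog_ne0 _ (piece i)); rewrite gtn_eqF //.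
  exact: leq_trans lt_ed (leq_addl _ _).
have lt_k : (e - d < k)%N by rewrite leq_max ltnS leq_subr orbT.
rewrite (bigD1 (Ordinal lt_k)) //= big1 => [|i]; last first.
  rewrite -(inj_eq val_inj) /= => ne; apply: (pihomog_ne0 _ (piece i)).
  by apply: contra ne => /eqP <-; rewrite addnK.
by rewrite addr0 pihomog_dE // -{2}(subnK le_de).
Qed.

Section InitialForms.
Variables (A : adicRing) (m r : nat) (t : 'I_r -> A).
Hypothesis gen_o : forall x, adic_o x <-> exists c : 'I_r -> A, x = \sum_i c i * t i.

Local Notation S := {mpoly {mpoly A[m]}[r]}.
Local Notation o_ := (ideal_exp (@adic_o A)).

(* A[X] -> A<X>, and then A[X][T] -> A<X> with T_i |-> t_i. *)
Definition poly_tate : {mpoly A[m]} -> tate A m := mmap (@tconst A m) (@tvar A m).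
HB.instance Definition _ := GRing.RMorphism.copy poly_tate
  (mmap (@tconst A m) (@tvar A m)).

Definition form_tate : S -> tate A m := mmap poly_tate (fun i => tconst m (t i)).
HB.instance Definition _ := GRing.RMorphism.copy form_tate
  (mmap poly_tate (fun i => tconst m (t i))).

(** Forms of degree e represent o(A)^e A<X> modulo o(A)^(e+1) A<X>, the graded piece of degree e;
    working with [F] in A[X][T] avoids quotients. *)
Definition is_form e (x : tate A m) : Prop :=
  exists2 F : S, F \is e.-homog for mdeg & x = form_tate F.

Lemma is_form0 e : is_form e 0.
Proof. by exists 0; [exact: dhomog0|rewrite rmorph0]. Qed.

Lemma is_formD e x y : is_form e x -> is_form e y -> is_form e (x + y).
Proof.
by move=> [F hF ->] [G hG ->]; exists (F + G); [exact: dhomogD|rewrite rmorphD].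
Qed.

Lemma is_formM d e x y : is_form d x -> is_form e y -> is_form (d + e) (x * y).
Proof.
by move=> [F hF ->] [G hG ->]; exists (F * G); [exact: dhomogM|rewrite rmorphM].
Qed.

Lemma is_form_sum e I s (P : pred I) (F : I -> tate A m) :
  (forall i, P i -> is_form e (F i)) -> is_form e (\sum_(i <- s | P i) F i).
Proof. by move=> h; apply: big_ind => //; [exact: is_form0|exact: is_formD]. Qed.

Lemma is_form_poly p : is_form 0 (poly_tate p).
Proof.
exists p%:MP; last by rewrite /form_tate mmapC.
by rewrite -[p%:MP]mulr1 mul_mpolyC; apply: dhomogZ; exact: dhomog1.
Qed.

Lemma is_form_const a : is_form 0 (tconst m a).
Proof. by have := is_form_poly a%:MP; rewrite /poly_tate mmapC. Qed.

Lemma is_form_gen i : is_form 1 (tconst m (t i)).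
Proof. by exists 'X_i; [rewrite dhomogX /= mdeg1|rewrite /form_tate mmapX mmap1U]. Qed.

Lemma is_form_o e a : o_ e a -> is_form e (tconst m a).
Proof.
elim: e a => [|e IH] a; first by move=> _; exact: is_form_const.
move=> [k [b [c [hb hc ->]]]]; rewrite rmorph_sum; apply: is_form_sum => i _.
rewrite rmorphM -[e.+1]/(1 + e)%N; apply: is_formM; last exact/IH/hc.
have [d ->] := (gen_o (b i)).1 (hb i); rewrite rmorph_sum.
apply: is_form_sum => j _; rewrite rmorphM; apply: (is_formM (d := 0)).
  exact: is_form_const.
exact: is_form_gen.
Qed.

Lemma gen_in_o i : o_ 1 (t i).
Proof.
exists 1%N, (fun=> t i), (fun=> 1); split=> //; last by rewrite big_ord1 mulr1.
move=> _; apply/gen_o; exists (fun j => (j == i)%:R).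
by rewrite (bigD1 i) //= eqxx mul1r big1 ?addr0 // => j /negPf ->; rewrite mul0r.
Qed.

Lemma tconst_o e a : o_ e a -> tate_o e (tconst m a).
Proof. by move=> ha mu /=; case: ifP => // _; exact: o0. Qed.

Lemma form_in_o e x : is_form e x -> tate_o e x.
Proof.
move=> [F hF ->]; rewrite /form_tate /mmap big_seq.
apply: tate_o_sum => nu hnu; apply: tate_oMl.
have <- : mdeg nu = e by exact: (dhomog_mf hF hnu).
rewrite mdegE /mmap1.
apply: (big_ind2 (fun x d => tate_o d x)) => [|x1 d1 x2 d2|i _].
- by move=> mu.
- exact: tate_o_mul.
elim: (nu i) => [|d IH]; first by move=> mu.
rewrite exprS -[d.+1]/(1 + d)%N; apply: tate_o_mul => //.
by apply: tconst_o; exact: gen_in_o.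
Qed.

(** All coefficients of [x] lie in o(A)^e, so every partial sum is a form of degree e; a long enough
    one differs from [x] by an element of o(A)^(e+1) A<X>. *)
Lemma initial_form e (x : tate A m) : tate_o e x ->
  exists2 F, is_form e F & tate_o e.+1 (x - F).
Proof.
move=> hx; have [d hd] := tsubst_cvg x (@tvar A m) e.+1.
have xE : tsubst x (@tvar A m) = x.
  by rewrite -[LHS]/(trename id x) trename_id.
exists (tate_psum x (tate_pow (@tvar A m)) d); last first.
  by apply: tate_oBC; rewrite -{2}xE; exact: hd.
apply: is_form_sum => nu _; rewrite -[e]addn0; apply: is_formM; first exact: is_form_o.
rewrite (_ : tate_pow _ _ = poly_tate 'X_[nu]); first exact: is_form_poly.
by rewrite /poly_tate mmapX.
Qed.

End InitialForms.

(** * Standard bases of ideals of A<X> *)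

Lemma tate_nat_series (A : adicRing) k (y : nat -> tate A k) :
    (forall e, exists N, forall l, (N <= l)%N -> tate_o e (y l)) ->
  exists l, tate_cvg (fun i => \sum_(0 <= j < i) y j) l.
Proof.
move=> y0; apply: tate_complete => e; have [N hN] := y0 e; exists N => i j hi hj.
rewrite (big_cat_nat (leq0n N) hi) (big_cat_nat (leq0n N) hj) /=.
rewrite opprD addrACA subrr add0r; apply: tate_oB.
  by rewrite big_nat; apply: tate_o_sum => l /andP[/hN].
by rewrite big_nat; apply: tate_o_sum => l /andP[/hN].
Qed.

Section StandardBasis.
Variables (A : adicRing) (m : nat) (I : set (tate A m)).
Hypothesis idI : is_ideal I.

(** Finitely many initial forms [a j], of degree [d j] and realized by [g j] in [I], generate all
    initial forms. That of [x] is homogeneous of degree [e], so its cofactors can be cut down to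
    their parts of degree [e - d j], whose values at [t] are the [q j]. [D] is the largest [d j]. *)
Lemma initial_form_basis : exists n (g : 'I_n -> tate A m) D,
  (forall j, I (g j)) /\ forall e x, I x -> tate_o e x ->
    exists q : 'I_n -> tate A m, (forall j, tate_o (e - D) (q j)) /\
      tate_o e.+1 (x - \sum_j q j * g j).
Proof.
have [r [t gen_o]] := adic_noetherian (@adic_o_ideal A).
pose S := {mpoly {mpoly A[m]}[r]}.
have noeS : noetherian S by do 2!apply: noetherian_mpoly; exact: adic_noetherian.
pose init (F : S) d g :=
  [/\ F \is d.-homog for mdeg, I g & tate_o d.+1 (g - form_tate t F)].
have [n [a [Ga genG]]] :=
  noetherian_gen [set F : S | exists d g, init F d g]%classic noeS.
have /choice[d] : forall j : 'I_n, exists d, exists g, init (a j) d g.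
  by move=> j; exact: Ga.
move=> /choice[g gP]; pose D := \max_j d j.
exists n, g, D; split=> [j|e x Ix ox]; first by have [] := gP j.
have [F' [F hF ->] oF] := initial_form gen_o ox.
have [c Fc] : in_span a n F by apply: genG; exists e, x.
pose P (j : 'I_n) : S := if (d j <= e)%N then pihomog mdeg (e - d j) (c j) else 0.
have FE : F = \sum_(j < n) P j * a j.
  rewrite -(pihomog_dE hF) [in LHS]Fc linear_sum; apply: eq_bigr => j _.
  by have [hj _ _] := gP j; rewrite -pihomogMr.
have oP j : (d j <= e)%N -> tate_o (e - d j) (form_tate t (P j)).
  move=> le_de; apply: (form_in_o gen_o); exists (P j) => //.
  by rewrite /P le_de; exact: pihomogP.
have P0 j : (d j <= e)%N = false -> P j = 0 by rewrite /P => ->.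
exists (fun j => form_tate t (P j)); split=> [j|].
  case le_de: (d j <= e)%N; last by rewrite P0 // rmorph0; exact: tate_o0.
  by apply: tate_o_le (oP j le_de); rewrite leq_sub2l // leq_bigmax.
rewrite -(subrK (form_tate t F) x) -addrA; apply: tate_oD => //.
rewrite {1}FE rmorph_sum -sumrB; apply: tate_o_sum => j _.
rewrite rmorphM -mulrBr; case le_de: (d j <= e)%N; last first.
  by rewrite P0 // rmorph0 mul0r; exact: tate_o0.
have -> : e.+1 = (e - d j + (d j).+1)%N by rewrite addnS subnK.
by apply: tate_o_mul; [exact: oP|apply: tate_oBC; have [] := gP j].
Qed.

(* An effective form of the Artin-Rees lemma, by successive approximation. *)
Lemma standard_basis : exists n (g : 'I_n -> tate A m) D,
  (forall j, I (g j)) /\ forall e x, I x -> tate_o e x ->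
    exists q : 'I_n -> tate A m, (forall j, tate_o (e - D) (q j)) /\
      x = \sum_j q j * g j.
Proof.
have [I0 ID IM] := idI; have [n [g [D [Ig step]]]] := initial_form_basis.
exists n, g, D; split=> // e x Ix ox.
(* One correction step, chosen for all pairs at once so that it can be iterated; pairs violating the
   hypotheses get the dummy value 0. *)
have /choice[Q QP] : forall ey : nat * tate A m, exists q : 'I_n -> tate A m,
    I ey.2 -> tate_o ey.1 ey.2 -> (forall j, tate_o (ey.1 - D) (q j)) /\
      tate_o ey.1.+1 (ey.2 - \sum_j q j * g j).
  move=> [e' y] /=.
  case: (pselect (I y /\ tate_o e' y)) => [[Iy oy]|ny].
    by have [q hq] := step e' y Iy oy; exists q.
  by exists (fun=> 0); move=> Iy oy; case: ny.
(* [X i] is the remainder after [i] corrections; it stays in [I] and lies in o(A)^(e + i) A<X>. *)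
pose X i := iteri i (fun i y => y - \sum_j Q ((e + i)%N, y) j * g j) x.
pose s i j := Q ((e + i)%N, X i) j.
have XS i : X i.+1 = X i - \sum_j s i j * g j by [].
have XP i : I (X i) /\ tate_o (e + i) (X i).
  elim: i => [|i [IX oX]]; first by rewrite addn0.
  rewrite addnS XS; have [_ ?] := QP (_, _) IX oX; split=> //.
  rewrite -mulN1r; apply: (ID) => //; apply: (IM).
  by apply: big_ind => // j _; exact: IM.
have os i j : tate_o (e + i - D) (s i j).
  by have [IX oX] := XP i; have [+ _] := QP (_, _) IX oX; apply.
have XE i : X i = x - \sum_j (\sum_(0 <= l < i) s l j) * g j.
  elim: i => [|i IH].
    by rewrite big1 ?subr0 // => j _; rewrite big_geq // mul0r.
  rewrite XS IH -addrA -opprD -big_split; congr (_ - _); apply: eq_bigr => j _.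
  by rewrite big_nat_recr //= mulrDl.
have /choice[q qP] : forall j, exists q, tate_cvg (fun i => \sum_(0 <= l < i) s l j) q.
  (* The correction of index [l] lies in o(A)^(e + l - D) A<X>; adding [D] to [e'] compensates the
     loss. *)
  move=> j; apply: tate_nat_series => e'; exists (e' + D)%N => l hl.
  apply: tate_o_le (os l j); rewrite leq_subRL; last first.
    by rewrite (leq_trans (leq_addl e' D)) // (leq_trans hl) ?leq_addl.
  by rewrite addnC (leq_trans hl) ?leq_addl.
exists q; split=> [j|].
  have [N /(_ N (leqnn N)) hN] := qP j (e - D)%N.
  rewrite -(subKr (\sum_(0 <= l < N) s l j) (q j)); apply: tate_oB => //.
  apply: tate_o_sum => l _; apply: tate_o_le (os l j).
  by rewrite leq_sub2r // leq_addr.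
apply: tate_separated => e'.
have /choice[N hN] : forall j, exists N, forall i, (N <= i)%N ->
    tate_o e' (\sum_(0 <= l < i) s l j - q j) by move=> j; exact: qP.
pose i := maxn e' (\max_j N j).
have -> : x - \sum_j q j * g j = X i + \sum_j (\sum_(0 <= l < i) s l j - q j) * g j.
  rewrite XE -addrA; congr (_ + _); rewrite addrC.
  rewrite -sumrN -sumrB; apply: eq_bigr => j _.
  by rewrite mulrBl addrAC subrr add0r.
apply: tate_oD.
  apply: tate_o_le (XP i).2; rewrite (leq_trans _ (leq_addl _ _)) //.
  exact: leq_maxl.
apply: tate_o_sum => j _; rewrite mulrC; apply: tate_oMl; apply: hN.
by rewrite leq_max leq_bigmax orbT.
Qed.

End StandardBasis.

(** * Finite generation by coefficients, and the extension *)

Section Coefficients.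
Variables (A : adicRing) (m N : nat).
Implicit Types (h Q : tate A (m + N)) (p : tate A m).

Lemma zcoef_inj h h' : (forall b, zcoef h b = zcoef h' b) -> h = h'.
Proof.
move=> hb; apply: tateP => c; rewrite [c]mnm_catK.
exact: (congr1 (fun f : tate A m => f _) (hb _)).
Qed.

Lemma zcoef_sum J s (P : pred J) (F : J -> tate A (m + N)) b :
  zcoef (\sum_(i <- s | P i) F i) b = \sum_(i <- s | P i) zcoef (F i) b.
Proof.
by apply: tateP => a; rewrite tate_sumE -[LHS]/((\sum_(i <- s | P i) F i) _) tate_sumE.
Qed.

Lemma zcoef_lshift p b :
  zcoef (trename (@lshift m N) p) b = if b == 0%MM then p else 0.
Proof.
have push_l a : mnm_push (@lshift m N) a = mnm_cat a 0%MM.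
  apply: mnm_catP => j; rewrite ?mnm_catl ?mnm_catr; first exact/pushE/lshift_inj.
  rewrite mnm0E mnm_sumE big1 // => i _.
  by rewrite mulmnE mnm1E eq_lrshift.
apply: tateP => a; rewrite -[LHS]/(trename (@lshift m N) p (mnm_cat a b)).
case: eqP => [->|nb]; first by rewrite -push_l trename_push //; exact: lshift_inj.
rewrite trename_npush // => nu; rewrite push_l => /mnm_cat_inj[_ /nb].
exact.
Qed.

Lemma zcoef_lshiftM p Q b : zcoef (trename (@lshift m N) p * Q) b = p * zcoef Q b.
Proof.
rewrite zcoefM (bigD1 (bm0 : 'X_{1..N < (mdeg b).+1})) /=; last first.
  by apply/mnm_lepP => i; rewrite mnmE.
rewrite zcoef_lshift eqxx subm0 big1 ?addr0 // => c /andP[_].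
by rewrite -(inj_eq val_inj) zcoef_lshift /= => /negPf ->; rewrite mul0r.
Qed.

(** For [b] of large degree the bound is uniform in the monomial of X; only finitely many [b]
    remain, and each [r b] is restricted. *)
Lemma zcoef_assemble (r : 'X_{1..N} -> tate A m) :
    (forall e, exists d, forall b, (d <= mdeg b)%N -> tate_o e (r b)) ->
  exists Q, forall b, zcoef Q b = r b.
Proof.
move=> r0; pose Q := MPSeries (fun c : 'X_{1..m + N} =>
  r [multinom c (rshift m i) | i < N] [multinom c (lshift N i) | i < m]).
have QE a b : Q (mnm_cat a b) = r b a.
  by rewrite /=; congr (pscoef (tate_val (r _)) _); apply/mnmP => i;
    rewrite mnmE ?mnm_catl ?mnm_catr.
have QR : restricted Q.
  apply/asboolP => e; have [d hd] := r0 e.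
  have /choice[d' hd'] : forall b, exists d', forall a, (d' <= mdeg a)%N ->
      ideal_exp (@adic_o A) e (r b a).
    by move=> b; exact: tate_null.
  exists (d + \max_(b : 'X_{1..N < d}) d' b)%N => c.
  rewrite [c]mnm_catK QE mdeg_cat; set a := [multinom c (lshift N i) | i < m].
  set b := [multinom c (rshift m i) | i < N] => hc.
  have [le_db|lt_bd] := leqP d (mdeg b); first exact: hd.
  apply: hd'.
  have /leq_trans := @leq_bigmax _ (fun b : 'X_{1..N < d} => d' b) (BMultinom lt_bd).
  apply=> /=.
  rewrite -(leq_add2l d); apply: leq_trans hc _.
  by rewrite addnC leq_add2r ltnW.
by exists (Tate QR) => b; apply: tateP => a; exact: QE.
Qed.

Lemma gen_ideal_widen h d d' x : (d <= d')%N ->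
  gen_ideal (fun c : 'X_{1..N < d} => zcoef h c) x ->
  gen_ideal (fun c : 'X_{1..N < d'} => zcoef h c) x.
Proof.
have [J0 JD JM] := gen_idealP (fun c : 'X_{1..N < d'} => zcoef h c).
move=> le_dd' [q ->]; apply: big_ind => // c _; rewrite mulrC; apply: JM.
exact: (gen_ideal_gen _ (BMultinom (leq_trans (bmdeg c) le_dd'))).
Qed.

(* This is where A being noetherian is used, twice: o(A) is finitely generated,
   and so is the ideal of initial forms. *)
Lemma zcoef_finite h : exists d (Q : 'X_{1..N < d} -> tate A (m + N)),
  h = \sum_(c : 'X_{1..N < d}) trename (@lshift m N) (zcoef h c) * Q c.
Proof.
pose J d := gen_ideal (fun c : 'X_{1..N < d} => zcoef h c).
pose I : set (tate A m) := [set x | exists d, J d x]%classic.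
have idI : is_ideal I.
  split=> [|x y [d hx] [d' hy]|a x [d hx]].
  - by exists 0%N; have [] := gen_idealP (fun c : 'X_{1..N < 0} => zcoef h c).
  - exists (maxn d d').
    have [_ JD _] := gen_idealP (fun c : 'X_{1..N < maxn d d'} => zcoef h c).
    by apply: JD; [apply: gen_ideal_widen hx|apply: gen_ideal_widen hy];
      rewrite ?leq_maxl ?leq_maxr.
  - exists d; have [_ _ JM] := gen_idealP (fun c : 'X_{1..N < d} => zcoef h c).
    exact: JM.
have Ih b : I (zcoef h b).
  by exists (mdeg b).+1; exact: (gen_ideal_gen _ (BMultinom (ltnSn (mdeg b)))).
have [n [g [D [Ig basis]]]] := standard_basis idI.
have /choice[dg dgP] : forall j, exists d, J d (g j) by [].
(* A common bound, so that all [g j] are combinations of the same finitely many coefficients of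
   [h]. *)
pose d := \max_j dg j.
have /choice[p pP] : forall j, J d (g j).
  by move=> j; apply: gen_ideal_widen (dgP j); exact: leq_bigmax.
(* One family [q] must serve all [e] at once: the one for the largest [e <= k] with [x] in o(A)^e
   A<X> does. The cap [k] is there because [x] may be 0; it will be [mdeg b], which still tends to
   infinity with [b]. *)
have basis_upto k x : I x -> exists q : 'I_n -> tate A m,
    x = \sum_j q j * g j /\
    forall e, (e <= k)%N -> tate_o e x -> forall j, tate_o (e - D) (q j).
  move=> Ix; elim: k => [|k [q [xE qP]]].
    have [|q [qP xE]] := basis 0%N x Ix; first by move=> mu.
    by exists q; split=> // e; rewrite leqn0 => /eqP ->.
  case: (pselect (tate_o k.+1 x)) => [ox|nox].
    have [q' [q'P xE']] := basis _ x Ix ox; exists q'; split=> // e le_e _ j.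
    by apply: tate_o_le (q'P j); rewrite leq_sub2r.
  exists q; split=> // e; rewrite leq_eqVlt => /orP[/eqP-> //|]; exact: qP.
have /choice[q qP] : forall b, exists q : 'I_n -> tate A m,
    zcoef h b = \sum_j q j * g j /\
    forall e, (e <= mdeg b)%N -> tate_o e (zcoef h b) -> forall j, tate_o (e - D) (q j).
  by move=> b; exact: basis_upto.
have /choice[Q QP] : forall c : 'X_{1..N < d}, exists Q, forall b,
    zcoef Q b = \sum_j q b j * p j c.
  move=> c; apply: zcoef_assemble => e.
  (* Beyond [d0] the coefficient [zcoef h b] lies in o(A)^(e + D) A<X>, and beyond [e + D] the cap
     [mdeg b] is harmless; losing [D] leaves exponent [e]. *)
  have [d0 hd0] := tate_null h (e + D)%N; exists (maxn d0 (e + D)) => b.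
  rewrite geq_max => /andP[h0 h1]; apply: tate_o_sum => j _.
  rewrite mulrC; apply: tate_oMl; rewrite -(addnK D e); apply: (qP b).2 => // a.
  by apply: hd0; rewrite mdeg_cat (leq_trans h0) ?leq_addl.
exists d, Q; apply: zcoef_inj => b; rewrite zcoef_sum.
under eq_bigr do rewrite zcoef_lshiftM QP big_distrr /=.
rewrite exchange_big /= [LHS](qP b).1; apply: eq_bigr => j _.
rewrite [in LHS]pP big_distrr; apply: eq_bigr => c _ /=.
by rewrite mulrCA.
Qed.

End Coefficients.

(** * The operations of R<Z> are well defined *)

Section Rangle.
Variables (A : adicRing) (R : Aring A) (N : nat).

Lemma zspec_sum m J s (P : pred J) (F : J -> tate A (m + N)) (x : 'I_m -> R) :
  zspec (\sum_(i <- s | P i) F i) x = \sum_(i <- s | P i) zspec (F i) x.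
Proof.
by apply: mpseriesP => b; rewrite coef_sum /= zcoef_sum Aiota_sum.
Qed.

Lemma zspec_tvar_l m (x : 'I_m -> R) i :
  zspec (tvar A (lshift N i)) x = psconst N (x i).
Proof.
apply: mpseriesP => b.
rewrite -(trename_var A (@lshift_inj m N) i) /= zcoef_lshift.
case: ifP => _; last exact: Aiota0.
exact: Aiota_var.
Qed.

Lemma zspec_tvar_r m (x : 'I_m -> R) (k : 'I_N) :
  zspec (tvar A (rshift m k)) x = psmon R U_(k)%MM.
Proof.
apply: mpseriesP => b /=.
have UE : U_(rshift m k)%MM = mnm_cat (0%MM : 'X_{1..m}) U_(k)%MM.
  apply: mnm_catP => i; rewrite ?mnm_catl ?mnm_catr !mnmE.
    by rewrite eq_rlshift.
  by rewrite (inj_eq (@rshift_inj _ _)).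
have -> : zcoef (tvar A (rshift m k)) b = (b == U_(k)%MM)%:R.
  apply: tateP => a /=; rewrite UE.
  case: (eqVneq b U_(k)%MM) => [->|nb] /=.
    by congr (_ %:R); congr nat_of_bool; apply/eqP/eqP => [/mnm_cat_inj[]|->].
  by case: eqP => // /mnm_cat_inj[_ e]; rewrite e eqxx in nb.
by case: eqP => _; rewrite ?Aiota1 ?Aiota0.
Qed.

(** After renaming to a common point, the difference lies in the ideal generated by the differences
    of the arguments, all of which specialize to 0 in R[[Z]]. *)
Lemma zspec_tsubst_eq m m' n (f : tate A n) (u : 'I_n -> tate A (m + N)) (x : 'I_m -> R)
    (u' : 'I_n -> tate A (m' + N)) (x' : 'I_m' -> R) :
  (forall j, zspec (u j) x = zspec (u' j) x') ->
  zspec (tsubst f u) x = zspec (tsubst f u') x'.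
Proof.
have [k [y [s [s' [gs gs' -> ->]]]]] := rangle_merge x x' => eu.
have [[inj_s _] [inj_s' _]] := (gs, gs').
rewrite -(spec_rename _ _ gs) -(spec_rename _ _ gs').
rewrite !trename_tsubst; try exact: sum_ord_inj.
apply/eqP; rewrite -subr_eq0 -specB; apply/eqP.
have [q ->] := tsubst_congruence f (fun j => trename (sum_ord s) (u j))
  (fun j => trename (sum_ord s') (u' j)).
rewrite zspec_sum big1 // => j _.
by rewrite specM specB !spec_rename // eu subrr mul0r.
Qed.

Lemma rangle_common_family n (v : 'I_n -> rangle R N) :
  exists m (u : 'I_n -> tate A (m + N)) (x : 'I_m -> R),
    forall j, v j = rangle_zspec (u j) x.
Proof.
elim: n v => [|n IH] v; first by exists 0%N, (fun=> 0), (fun=> 0) => -[].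
have [m [u [x hu]]] := IH (fun j => v (lift ord0 j)).
have /asboolP[m' [h [x' hh]]] := valP (v ord0).
have [k [y [s [s' [gs gs' ex ex']]]]] := rangle_merge x x'.
exists k, (fun j => if unlift ord0 j is Some i then trename (sum_ord s) (u i)
                    else trename (sum_ord s') h), y.
move=> j; apply: val_inj; case: unliftP => [i ->|->] /=.
  by rewrite hu /= spec_rename // ex.
by rewrite -[LHS]/(val (v ord0)) hh spec_rename // ex'.
Qed.

Lemma rangle_iotaP n (f : tate A n) (v : 'I_n -> rangle R N) :
  exists m (u : 'I_n -> tate A (m + N)) (x : 'I_m -> R),
    (forall j, v j = rangle_zspec (u j) x) /\
    rangle_iota f v = rangle_zspec (tsubst f u) x.
Proof.
have [m [u [x hu]]] := rangle_common_family v.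
rewrite /rangle_iota; case: xgetP => [w _ [m' [u' [x' [hu' ->]]]]|nw].
  by exists m', u', x'.
by case: (nw (rangle_zspec (tsubst f u) x)); exists m, u, x.
Qed.

Lemma rangle_iota_zspec m n (f : tate A n) (u : 'I_n -> tate A (m + N)) (x : 'I_m -> R) :
  rangle_iota f (fun j => rangle_zspec (u j) x) = rangle_zspec (tsubst f u) x.
Proof.
have [m' [u' [x' [hu ->]]]] := rangle_iotaP f (fun j => rangle_zspec (u j) x).
apply: val_inj; apply: zspec_tsubst_eq => j.
exact: (congr1 val (esym (hu j))).
Qed.

(** Substituting the variables into [h] gives [h] back. So every element of R<Z> is a value of some
    [h] at constants and variables, which forces uniqueness of the extension. *)
Lemma rangle_zspec_iota m (h : tate A (m + N)) (x : 'I_m -> R) :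
  rangle_zspec h x = rangle_iota h (fun j => rangle_zspec (tvar A j) x).
Proof.
rewrite rangle_iota_zspec; congr rangle_zspec.
by rewrite -[RHS]/(trename id h) trename_id.
Qed.

End Rangle.

(** * Evaluation at (phi(x), z) and the extension *)

Definition point_cat T m N (y : 'I_m -> T) (z : 'I_N -> T) (i : 'I_(m + N)) : T :=
  match split i with inl j => y j | inr j => z j end.

Lemma point_cat_l T m N (y : 'I_m -> T) (z : 'I_N -> T) i :
  point_cat y z (lshift N i) = y i.
Proof. by rewrite /point_cat (unsplitK (inl i)). Qed.

Lemma point_cat_r T m N (y : 'I_m -> T) (z : 'I_N -> T) i :
  point_cat y z (rshift m i) = z i.
Proof. by rewrite /point_cat (unsplitK (inr i)). Qed.

Lemma point_cat_sum_ord T m k N (y : 'I_k -> T) (z : 'I_N -> T) (s : 'I_m -> 'I_k) :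
  point_cat y z \o sum_ord s = point_cat (y \o s) z.
Proof.
apply/funext => i; rewrite /= -(splitK i) /sum_ord unsplitK.
case: (split i) => j /=; first by rewrite !point_cat_l.
by rewrite !point_cat_r.
Qed.

Section Extension.
Variables (A : adicRing) (R Rstar : Aring A) (phi : R -> Rstar).
Hypothesis phiM : Aring_morphism (@Aiota A R) (@Aiota A Rstar) phi.
Variables (N : nat) (z : 'I_N -> Rstar).

Definition eval_at m (h : tate A (m + N)) (x : 'I_m -> R) : Rstar :=
  Aiota h (point_cat (phi \o x) z).

(** Evaluation in an A-ring respects finite sums only, hence the finite expression of [h] through
    its coefficients. These vanish at [x], and therefore at [phi \o x], since [phi] commutes with
    them. *)
Lemma eval_at_eq0 m (h : tate A (m + N)) (x : 'I_m -> R) :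
  zspec h x = 0 -> eval_at h x = 0.
Proof.
have [[[phi0 _] _] phi_iota] := phiM.
move=> h0; have [d [Q hE]] := zcoef_finite h.
rewrite /eval_at hE Aiota_sum big1 // => c _.
rewrite AiotaM Aiota_trename.
have -> : point_cat (phi \o x) z \o @lshift m N = (fun i => phi (x i)).
  by apply/funext => i /=; rewrite point_cat_l.
rewrite -phi_iota -[Aiota _ x]/(zspec h x c) h0 phi0 mul0r //.
Qed.

Lemma eval_at_rename m k (s : 'I_m -> 'I_k) (h : tate A (m + N)) (y : 'I_k -> R) :
  eval_at (trename (sum_ord s) h) y = eval_at h (y \o s).
Proof. by rewrite /eval_at Aiota_trename point_cat_sum_ord. Qed.

Lemma eval_at_eq m m' (h : tate A (m + N)) (x : 'I_m -> R)
    (h' : tate A (m' + N)) (x' : 'I_m' -> R) :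
  zspec h x = zspec h' x' -> eval_at h x = eval_at h' x'.
Proof.
have [k [y [s [s' [gs gs' -> ->]]]]] := rangle_merge x x'.
rewrite -(spec_rename _ _ gs) -(spec_rename _ _ gs').
rewrite -(eval_at_rename s) -(eval_at_rename s') => e.
apply/eqP; rewrite -subr_eq0 /eval_at -AiotaB; apply/eqP.
by apply: eval_at_eq0; rewrite specB e subrr.
Qed.

Lemma rangle_extension : exists psi : rangle R N -> Rstar,
  forall m (h : tate A (m + N)) x, psi (rangle_zspec h x) = eval_at h x.
Proof.
have /choice[psi psiP] : forall p : rangle R N, exists v, forall m (h : tate A (m + N)) x,
    val p = zspec h x -> v = eval_at h x.
  move=> p; have /asboolP[m [h [x hp]]] := valP p; exists (eval_at h x) => m' h' x'.
  by rewrite hp; exact: eval_at_eq.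
by exists psi => m h x; exact: psiP.
Qed.

End Extension.

Theorem theorem5p5 (A : adicRing) (R Rstar : Aring A) (phi : R -> Rstar)
    (phi_morphism : Aring_morphism (@Aiota A R) (@Aiota A Rstar) phi)
    (N : nat) (z : 'I_N -> Rstar) :
  exists! psi : rangle R N -> Rstar,
    [/\ Aring_morphism (@rangle_iota A R N) (@Aiota A Rstar) psi,
        forall r : R, psi (rangle_const N r) = phi r &
        forall k : 'I_N, psi (rangle_var R k) = z k].
Proof.
have [psi psiE] := rangle_extension phi_morphism z.
have eval_var_l m (x : 'I_m -> R) i : eval_at phi z (tvar A (lshift N i)) x = phi (x i).
  by rewrite /eval_at Aiota_var point_cat_l.
have eval_var_r m (x : 'I_m -> R) k : eval_at phi z (tvar A (rshift m k)) x = z k.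
  by rewrite /eval_at Aiota_var point_cat_r.
have constE m (x : 'I_m -> R) i :
    rangle_const N (x i) = rangle_zspec (tvar A (lshift N i)) x.
  by apply: val_inj; rewrite /= zspec_tvar_l.
have varE m (x : 'I_m -> R) (k : 'I_N) :
    rangle_var R k = rangle_zspec (tvar A (rshift m k)) x.
  by apply: val_inj; rewrite /= zspec_tvar_r.
have common (p q : rangle R N) : exists m (h h' : tate A (m + N)) (x : 'I_m -> R),
    p = rangle_zspec h x /\ q = rangle_zspec h' x.
  have [m [h [h' [x [hp hq]]]]] := rangle_common (valP p) (valP q).
  by exists m, h, h', x; split; apply: val_inj.
have psiB p q : psi (p - q) = psi p - psi q.
  have [m [h [h' [x [-> ->]]]]] := common p q.
  have -> : rangle_zspec h x - rangle_zspec h' x = rangle_zspec (h - h') x.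
    by apply: val_inj; rewrite /= specB.
  by rewrite !psiE /eval_at AiotaB.
have psi0 : psi 0 = 0 by rewrite -(subrr 0) psiB subrr.
exists psi; split; first split.
- split; [split; split|].
  + exact: psi0.
  + by move=> p q; rewrite -{1}(opprK q) -[- q]sub0r !psiB psi0 sub0r opprK.
  + have -> : 1 = rangle_zspec 1 (fun _ : 'I_0 => 0) :> rangle R N.
      by apply: val_inj; rewrite /= spec1.
    by rewrite psiE /eval_at Aiota1.
  + move=> p q; have [m [h [h' [x [-> ->]]]]] := common p q.
    have -> : rangle_zspec h x * rangle_zspec h' x = rangle_zspec (h * h') x.
      by apply: val_inj; rewrite /= specM.
    by rewrite !psiE /eval_at AiotaM.
  + move=> n f v; have [m [u [x [hv ->]]]] := rangle_iotaP f v.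
    rewrite psiE /eval_at Aiota_tsubst; congr Aiota; apply/funext => j.
    by rewrite hv psiE.
(* The constant [r] is the value of X_1 at the one-coordinate point [r]. *)
- by move=> r; rewrite (constE 1%N (fun=> r) ord0) psiE eval_var_l.
- by move=> k; rewrite (varE 0%N (fun=> 0)) psiE eval_var_r.
move=> psi' [[_ psi'_iota] psi'_const psi'_var]; apply/funext => p.
have [m [h [_ [x [-> _]]]]] := common p p.
(* Compatibility with the operations moves [psi'] inside [h], where it meets only constants and
   variables. *)
rewrite psiE rangle_zspec_iota psi'_iota /eval_at; congr Aiota; apply/funext => j.
rewrite -(splitK j); case: (split j) => i /=.
  by rewrite point_cat_l -constE psi'_const.
by rewrite point_cat_r -varE psi'_var.
Qed.
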